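(* Let $m\ge2$. Let $\Omega$ be a body in $\mathbb{R}^m$ whose complement satisfies the uniform interior cone condition of aperture angle $\kappa$ and height $\delta$, where $0<\kappa\le\pi$ and $0<\delta\le+\infty$. Let $\tilde R=\tilde R(-1,\kappa,\delta,\operatorname{diam}\Omega,R_\infty(\Omega))$. Then for any $0<b<1$ there exists $h_0>0$ such that, for any $0<h<h_0$, any illuminating center of $\Omega$ of height $h$ is contained in the intersection $(\Omega\sim b\tilde R B^m)\cap Uf(\Omega)$.
   Context: A body in $\mathbb{R}^m$ is the closure of a bounded open set. $\Omega^c$ is the complement, $B_\rho(x)$ the closed ball of radius $\rho$ centered at $x$, $R_\infty(\Omega)=\max_{\xi\in\Omega}\operatorname{dist}(\xi,\Omega^c)$ the inradius, and $\Omega\sim\rho B^m=\{x\in\Omega:\operatorname{dist}(x,\Omega^c)\ge\rho\}$. Solid angle function: $A_\Omega(x,h)=h\int_\Omega\left(|x-\xi|^2+h^2\right)^{-(m+1)/2}d\xi$ for $x\in\mathbb{R}^m$, $h>0$. An illuminating center of $\Omega$ of height $h$ is a point of $\mathbb{R}^m$ at which $A_\Omega(\cdot,h)$ attains its maximum over $\mathbb{R}^m$. The open cone of vertex $x$, axis direction $v\in S^{m-1}$, aperture angle $\kappa$ and height $\delta$ is $\{x+\rho w: 0<\rho<\delta,\ w\in S^{m-1},\ w\cdot v>\cos(\kappa/2)\}$. An open set $U$ satisfies the uniform interior cone condition of aperture angle $\kappa$ and height $\delta$ if for each $x\in U$ there is an open cone of vertex $x$, aperture angle $\kappa$ and height $\delta$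 contained in $U$. Minimal unfolded region: for $v\in S^{m-1}$, $b\in\mathbb{R}$, let $\operatorname{Refl}_{v,b}$ be the reflection in the hyperplane $\{z: z\cdot v=b\}$, $\Omega_{v,b}^+=\Omega\cap\{z: z\cdot v\ge b\}$, $l(v)=\min\{a\in\mathbb{R}:\forall b\ge a,\ \operatorname{Refl}_{v,b}(\Omega_{v,b}^+)\subset\Omega\}$, and $Uf(\Omega)=\bigcap_{v\in S^{m-1}}\{z: z\cdot v\le l(v)\}$. Definition of $\tilde R$ (for $\alpha\le0$): let $C_\theta(x;\kappa,\delta)$ be the open cone of vertex $x$, axis direction $\cos\theta\, e_1+\sin\theta\, e_m$, aperture angle $\kappa$ and height $\delta$. For $D>0$, $0<R_0<D$ and $R>0$ put $E(R)=\min_{0\le\theta\le(\pi-\kappa)/2}\left(\int_{C_\theta(Re_1;\kappa,\delta)\cap B_D(0)}|\xi|^{\alpha-m}d\xi-\int_{B_D(0)\setminus B_{R_0}(0)}|\xi|^{\alpha-m}d\xi\right).$ There is a unique positive number $\tilde R=\tilde R(\alpha,\kappa,\delta,D,R_0)$ with $E(\tilde R)=0$; moreover $E(R)>0$ for $R<\tilde R$, $E(R)<0$ for $R>\tilde R$, and $\tilde R<R_0$. *)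

(* Defs.v *)
From HB Require Import structures.
From mathcomp Require Import all_boot all_order all_algebra.
From mathcomp Require Import all_classical all_reals all_analysis.

Set Implicit Arguments.
Unset Strict Implicit.
Unset Printing Implicit Defensive.

Import Order.TTheory GRing.Theory Num.Theory.
Import numFieldNormedType.Exports.

Local Open Scope classical_set_scope.
Local Open Scope ring_scope.

(* R^m is 'rV[R]_m.  Its library norm is the sup norm, which is used only
   through the topology and the bornology it induces; the geometry uses the
   Euclidean norm enorm below. *)

Section MeasurableRow.
Context {R : realType}.
Variable m : nat.

Let coors : 'I_m -> 'rV[R]_m -> measurableTypeR R := fun i x => x ord0 i.

Let rV_set0 : g_sigma_preimage coors set0.
Proof. exact: sigma_algebra0. Qed.

Let rV_setC A : g_sigma_preimage coors A -> g_sigma_preimage coors (~` A).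
Proof. exact: sigma_algebraC. Qed.

Let rV_bigcup (F : (set 'rV[R]_m)^nat) :
  (forall i, g_sigma_preimage coors (F i)) ->
  g_sigma_preimage coors (\bigcup_i (F i)).
Proof. exact: sigma_algebra_bigcup. Qed.

(* The product sigma-algebra, as the library does for n.-tuple T. *)
HB.instance Definition _ := @isMeasurable.Build default_measure_display
  'rV[R]_m (g_sigma_preimage coors) rV_set0 rV_setC rV_bigcup.

End MeasurableRow.

Lemma sigma_finite_measure_ex d (T : measurableType d) (R : realType)
    (nu : set T -> \bar R) :
  nu set0 = 0%E -> (forall A, (0 <= nu A)%E) -> semi_sigma_additive nu ->
  sigma_finite setT nu ->
  {mu : {sigma_finite_measure set T -> \bar R} | nu = mu :> (set T -> \bar R)}.
Proof.
move=> nu0 nu_ge0 nu_sigma nu_fin.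
pose I1 := isMeasure.Build _ _ _ nu nu0 nu_ge0 nu_sigma.
pose M : {measure set T -> \bar R} := HB.pack nu I1.
pose I2 := Measure_isSigmaFinite.Build _ _ _ M nu_fin.
pose S : {sigma_finite_measure set T -> \bar R} := HB.pack nu I1 I2.
by exists S.
Qed.

(* Sigma-finiteness of m1 \x m2 is reproved here: the library's instance is
   shadowed by the one for subprobabilities. *)
Lemma pushforward_product_sigma_finite d1 d2 d3 (T1 : measurableType d1)
    (T2 : measurableType d2) (T3 : measurableType d3) (R : realType)
    (m1 : {sigma_finite_measure set T1 -> \bar R})
    (m2 : {sigma_finite_measure set T2 -> \bar R})
    (f : T1 * T2 -> T3) (g : T3 -> T1 * T2) :
  measurable_fun setT f -> measurable_fun setT g -> cancel f g ->
  {mu : {sigma_finite_measure set T3 -> \bar R} |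
    pushforward (m1 \x m2)%E f = mu :> (set T3 -> \bar R)}.
Proof.
move=> mf mg fK.
pose pnu := pushforward (m1 \x m2)%E f.
have pnu0 : pnu set0 = 0%E by rewrite /pnu /pushforward preimage_set0 measure0.
have pnu_ge0 A : (0 <= pnu A)%E by exact: measure_ge0.
have mfV A : measurable A -> measurable (f @^-1` A).
  by move=> mA; rewrite -[X in measurable X]setTI; exact: mf.
have pnu_sigma : semi_sigma_additive pnu.
  move=> F mF tF mUF; rewrite /pnu /pushforward preimage_bigcup.
  apply: measure_semi_sigma_additive.
  - by move=> n; exact: mfV.
  - apply/trivIsetP => /= i j _ _ ij; rewrite -preimage_setI.
    by move/trivIsetP : tF => /(_ _ _ _ _ ij) ->//; rewrite preimage_set0.
  - by rewrite -preimage_bigcup; exact: mfV.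
have pnu_fin : sigma_finite setT pnu.
  have /sigma_finiteP[F [TF ndF Foo]] := sigma_finiteT m1.
  have /sigma_finiteP[G [TG ndG Goo]] := sigma_finiteT m2.
  exists (fun k => g @^-1` (F k `*` G k)).
    rewrite -preimage_bigcup (_ : \bigcup_k _ = setT) ?preimage_setT//.
    rewrite -setXTT TF TG predeqE => -[x y]; split.
      by move=> [n _ []/= ? ?]; split; exists n.
    move=> [/= [n _ Fnx] [k _ Gky]]; exists (maxn n k) => //; split.
    - by move: x Fnx; exact/subsetPset/ndF/leq_maxl.
    - by move: y Gky; exact/subsetPset/ndG/leq_maxr.
  move=> k; have [? ?] := Foo k; have [? ?] := Goo k; split.
    by rewrite -[X in measurable X]setTI; apply: mg => //; exact: measurableX.
  rewrite /pnu /pushforward -comp_preimage (_ : _ \o _ = id)//.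
    by rewrite product_measure1E// lte_mul_pinfty// ge0_fin_numE.
  by apply/funext => x; exact: fK.
exact: sigma_finite_measure_ex pnu0 pnu_ge0 pnu_sigma pnu_fin.
Qed.

Section LebesgueRow.
Context {R : realType}.
Local Open Scope ereal_scope.

Definition rV_cons (n : nat) (p : measurableTypeR R * 'rV[R]_n) : 'rV[R]_n.+1 :=
  @row_mx _ 1 1 n (const_mx p.1) p.2.

(* m-dimensional Lebesgue measure: the m-fold product of lebesgue_measure. *)
Fixpoint lebesgue_rV (m : nat) : set 'rV[R]_m -> \bar R :=
  match m with
  | 0 => \d_(0%R : 'rV[R]_0)
  | n.+1 => pushforward (lebesgue_measure \x @lebesgue_rV n) (@rV_cons n)
  end.

Lemma measurable_coord n (i : 'I_n) :
  measurable_fun setT (fun x : 'rV[R]_n => x ord0 i : measurableTypeR R).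
Proof.
move=> _ Y mY; rewrite setTI; apply: sub_sigma_algebra => /=.
rewrite -bigcup_seq/=; exists i => /=; first by rewrite mem_index_enum.
by exists Y => //; rewrite setTI.
Qed.

Lemma measurable_rVP d (T : measurableType d) n (f : T -> 'rV[R]_n) :
  (forall i, measurable_fun setT (fun t => f t ord0 i : measurableTypeR R)) ->
  measurable_fun setT f.
Proof.
move=> mf _ A mA; rewrite setTI.
suff : g_sigma_preimage (fun (i : 'I_n) (t : T) => f t ord0 i : measurableTypeR R)
         `<=` measurable.
  apply; have := @g_sigma_preimage_comp _ (measurableTypeR R) n 'rV[R]_n
    (fun i x => x ord0 i) T f.
  rewrite /comp => ->.
  by exists A => //; rewrite setTI.
apply: smallest_sub; first exact: sigma_algebra_measurable.
rewrite -bigcup_seq; apply: bigcup_sub => i _ B [C mC <-].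
exact: mf.
Qed.

Let rV_cons_lshift n a x (j : 'I_1) :
  @rV_cons n (a, x) ord0 (lshift n j : 'I_(1 + n)) = a.
Proof. exact: (etrans (@row_mxEl _ 1 1 n (const_mx a) x _ _) (mxE _ _ _ _)). Qed.

Let rV_cons_rshift n a x (j : 'I_n) :
  @rV_cons n (a, x) ord0 (rshift 1 j : 'I_(1 + n)) = x ord0 j.
Proof. exact: (@row_mxEr _ 1 1 n (const_mx a) x). Qed.

Lemma measurable_rV_cons n : measurable_fun setT (@rV_cons n).
Proof.
apply: measurable_rVP => i.
case: (splitP (i : 'I_(1 + n))) => j ij.
  rewrite (_ : (fun _ => _) = fst); first exact: measurable_fst.
  have -> : i = lshift n j by apply: val_inj.
  by apply/funext => -[a x]; exact: rV_cons_lshift.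
have -> : i = rshift 1 j by apply: val_inj.
rewrite (_ : (fun _ => _) =
  (fun x : 'rV[R]_n => x ord0 j : measurableTypeR R) \o snd).
  by apply: measurableT_comp; [exact: measurable_coord|exact: measurable_snd].
by apply/funext => -[a x]; exact: rV_cons_rshift.
Qed.

Let rV_uncons n (x : 'rV[R]_n.+1) : measurableTypeR R * 'rV[R]_n :=
  (x ord0 ord0, @rsubmx _ 1 1 n x).

Let rV_consK n : cancel (@rV_cons n) (@rV_uncons n).
Proof.
move=> -[a x]; rewrite /rV_uncons /rV_cons /= row_mxKr; congr (_, _).
have -> : ord0 = lshift n (ord0 : 'I_1) :> 'I_(1 + n) by apply: val_inj.
exact: rV_cons_lshift.
Qed.

Let measurable_rV_uncons n : measurable_fun setT (@rV_uncons n).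
Proof.
apply: measurable_fun_pair; first exact: measurable_coord.
apply: measurable_rVP => i.
rewrite (_ : (fun _ => _) =
  (fun x : 'rV[R]_n.+1 => x ord0 (rshift 1 i) : measurableTypeR R)).
  exact: measurable_coord.
by apply/funext => x; rewrite mxE.
Qed.

Let lebesgue_rV_ex m :
  {mu : {sigma_finite_measure set 'rV[R]_m -> \bar R} |
    @lebesgue_rV m = mu :> (set 'rV[R]_m -> \bar R)}.
Proof.
elim: m => [|n [mu muE]]; first by exists (\d_(0%R : 'rV[R]_0)).
rewrite /= muE; exact: (pushforward_product_sigma_finite _ _
  (@measurable_rV_cons n) (@measurable_rV_uncons n) (@rV_consK n)).
Qed.

Let lebesgue_rV0 m : @lebesgue_rV m set0 = 0.
Proof. by have [mu ->] := lebesgue_rV_ex m; exact: measure0. Qed.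

Let lebesgue_rV_ge0 m A : 0 <= @lebesgue_rV m A.
Proof. by have [mu ->] := lebesgue_rV_ex m; exact: measure_ge0. Qed.

Let lebesgue_rV_sigma_additive m : semi_sigma_additive (@lebesgue_rV m).
Proof.
by have [mu ->] := lebesgue_rV_ex m; exact: measure_semi_sigma_additive.
Qed.

Let lebesgue_rV_sigma_finite m : sigma_finite setT (@lebesgue_rV m).
Proof. by have [mu ->] := lebesgue_rV_ex m; exact: sigma_finiteT. Qed.

HB.instance Definition _ m := isMeasure.Build _ _ _ (@lebesgue_rV m)
  (lebesgue_rV0 m) (@lebesgue_rV_ge0 m) (@lebesgue_rV_sigma_additive m).

HB.instance Definition _ m := Measure_isSigmaFinite.Build _ _ _
  (@lebesgue_rV m) (@lebesgue_rV_sigma_finite m).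

End LebesgueRow.
Arguments lebesgue_rV {R} m.

Section Euclidean.
Context {R : realType} {m : nat}.
Implicit Types (u v x : 'rV[R]_m) (A B : set 'rV[R]_m).

Definition dotv u v : R := \sum_(i < m) u ord0 i * v ord0 i.

Definition enorm v : R := Num.sqrt (dotv v v).

Definition sphere : set 'rV[R]_m := [set v | enorm v = 1].

Definition eball (r : R) x : set 'rV[R]_m := [set y | enorm (y - x) <= r].

Definition distv x A : R := inf [set enorm (x - y) | y in A].

Definition diam A : R := sup [set enorm (p.1 - p.2) | p in A `*` A].

Definition body A : Prop := exists U : set 'rV[R]_m,
  [/\ open U, bounded_set U, U !=set0 & A = closure U].

(* The supremum is a maximum when A is a body. *)
Definition inradius A : R := sup [set distv x (~` A) | x in A].

Definition inner_parallel A (r : R) : set 'rV[R]_m :=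
  A `&` [set x | r <= distv x (~` A)].

Definition open_cone x v (kappa : R) (delta : \bar R) : set 'rV[R]_m :=
  [set y | exists r w, [/\ 0 < r /\ (r%:E < delta)%E, sphere w,
                           cos (kappa / 2) < dotv w v & y = x + r *: w]].

Definition uniform_interior_cone A (kappa : R) (delta : \bar R) : Prop :=
  open A /\ forall x, A x ->
    exists2 v, sphere v & open_cone x v kappa delta `<=` A.

Definition refl v (b : R) x : 'rV[R]_m := x - (2 * (dotv x v - b)) *: v.

(* The infimum is a minimum when A is a body and v a unit vector. *)
Definition folding_level A v : R :=
  inf [set a | forall b, a <= b ->
         refl v b @` (A `&` [set z | b <= dotv z v]) `<=` A].

Definition minimal_unfolded_region A : set 'rV[R]_m :=
  \bigcap_(v in sphere) [set z | dotv z v <= folding_level A v].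

Definition solid_angle A (x : 'rV[R]_m) (h : R) : \bar R :=
  (h%:E * \int[lebesgue_rV m]_(xi in A)
            ((enorm (x - xi) ^+ 2 + h ^+ 2) `^ (- (m.+1%:R / 2)))%:E)%E.

Definition illuminating_center A (h : R) x : Prop :=
  forall y, (solid_angle A y h <= solid_angle A x h)%E.

End Euclidean.
Arguments sphere {R m}.

Section TildeR.
Context {R : realType} (m : nat).
Variables (alpha kappa : R) (delta : \bar R) (D R0 : R).

(* Coordinates are numbered from 0: evec 0 is e_1 and evec m.-1 is e_m. *)
Definition evec (k : nat) : 'rV[R]_m := \row_(i < m) (i == k :> nat)%:R.

Definition cone_theta (theta : R) (x : 'rV[R]_m) : set 'rV[R]_m :=
  open_cone x (cos theta *: evec 0 + sin theta *: evec m.-1) kappa delta.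

Definition power_integral (A : set 'rV[R]_m) : \bar R :=
  (\int[lebesgue_rV m]_(xi in A) (enorm xi `^ (alpha - m%:R))%:E)%E.

(* The infimum over theta is a minimum. *)
Definition E_tildeR (r : R) : \bar R :=
  ereal_inf [set (power_integral (cone_theta theta (r *: evec 0) `&` eball D 0)
                  - power_integral (eball D 0 `\` eball R0 0))%E
            | theta in `[0, (pi - kappa) / 2]].

(* The unique positive zero of E_tildeR; the default 0 is never used when
   alpha <= 0, 0 < kappa <= pi, 0 < delta and 0 < R0 < D. *)
Definition tildeR : R := xget 0 [set r | 0 < r /\ E_tildeR r = 0%E].

End TildeR.

(* Main.v *)
Require Import Defs.
From HB Require Import structures.
From mathcomp Require Import all_boot all_order all_algebra.
From mathcomp Require Import ring lra.
From mathcomp Require Import all_classical all_reals all_analysis.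
From mathcomp Require Import measurable_realfun.

Set Implicit Arguments.
Unset Strict Implicit.
Unset Printing Implicit Defensive.

Import Order.TTheory GRing.Theory Num.Theory.
Import numFieldNormedType.Exports.

Local Open Scope classical_set_scope.
Local Open Scope ring_scope.

(** Let $x$ be an illuminating center of height $h$, that is, a maximum of
$\int_\Omega(|x-\xi|^2+h^2)^{-(m+1)/2}d\xi$.

Position relative to hyperplanes. Suppose that $x\cdot v>b$ and that the reflection $R$
in $\{z\cdot v=b\}$ maps the part of $\Omega$ above this hyperplane into $\Omega$. Points
of $\Omega$ that are not matched by their mirror image in $\Omega$ lie below the
hyperplane and are closer to $Rx$ than to $x$, so $Rx$ receives at least as much light as
$x$, and strictly more unless $\Omega$ is symmetric
(center_reflection_symmetric). If $x\cdot v$ exceeded $l(v)$, $\Omega$ would be symmetric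
in two parallel hyperplanes, hence invariant under a translation, which is impossible for
a bounded set; so $x\in Uf(\Omega)$ (center_in_unfolded). The same argument puts $x$ in
every half-space containing $\Omega$, whence $\Omega\subset B_D(x)$ for
$D=\mathrm{diam}\,\Omega$ (body_sub_eball_center).

Distance to the complement. Compare $x$ with the center of an inscribed ball. Since
$\Omega\subset B_D(x)$, maximality bounds the light lost at $x$, the integral over
$B_D(x)\setminus\Omega$, by the integral over the shell $B_D\setminus B_{R_\infty}$, hence
by its weight $K=\int|\xi|^{-m-1}d\xi$, uniformly in $h$ (center_shadow). On the other
hand the complement contains a cone with vertex at the point of its closure nearest to
$x$ (interior_cone_closure).
If that point is $x$ itself, the light lost in the cone is at least $C/h$
(light_cone_vertex), which exceeds $K$ for small $h$; so $x$ is an interior point of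
$\Omega$. If it lies at a distance $r$ with $0<r<b\tilde R$, the inscribed ball around
$x$ forces the cone to open away from $x$, within the range of angles over which $E$
minimizes (cone_dir_nonobtuse, cone_angle_le). A cone of the same shape at distance
$\tilde R$ has weight at least $K$ because $E(\tilde R)=0$ (tildeR_cone_weight). Moving
it toward $x$ to distance $r\le b\tilde R$ decreases all squared distances by a fixed
proportion, half of which pays for the term $h^2$, so the light lost in the cone is at
least $qK$ with a constant $q>1$ (light_cone_translate). This contradicts the bound $K$.

Both parts use that the Lebesgue measure, defined as an iterated product, is invariant
under reflections and rotations. Invariance under translations follows slice by slice,
and the uniqueness argument for translation invariant measures then yields every linear
isometry (preserves_isometry). *)

(** * Euclidean geometry and topology *)

Section EuclideanSpace.
Context {R : realType} {m : nat}.
Implicit Types (u v w x y : 'rV[R]_m) (a b r : R) (A : set 'rV[R]_m).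

Lemma dotvC u v : dotv u v = dotv v u.
Proof. by apply: eq_bigr => i _; rewrite mulrC. Qed.

Lemma dotvDl u v w : dotv (u + v) w = dotv u w + dotv v w.
Proof. by rewrite -big_split; apply: eq_bigr => i _; rewrite mxE mulrDl. Qed.

Lemma dotvZl a u v : dotv (a *: u) v = a * dotv u v.
Proof. by rewrite mulr_sumr; apply: eq_bigr => i _; rewrite mxE mulrA. Qed.

Lemma dotvDr u v w : dotv w (u + v) = dotv w u + dotv w v.
Proof. by rewrite dotvC dotvDl !(dotvC w). Qed.

Lemma dotvZr a u v : dotv u (a *: v) = a * dotv u v.
Proof. by rewrite dotvC dotvZl dotvC. Qed.

Lemma dotvNl u v : dotv (- u) v = - dotv u v.
Proof. by rewrite -scaleN1r dotvZl mulN1r. Qed.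

Lemma dotvNr u v : dotv u (- v) = - dotv u v.
Proof. by rewrite dotvC dotvNl dotvC. Qed.

Definition dotvE := (dotvDl, dotvDr, dotvZl, dotvZr, dotvNl, dotvNr).

Lemma dotv_ge0 u : 0 <= dotv u u.
Proof. by apply: sumr_ge0 => i _; rewrite -expr2 sqr_ge0. Qed.

Lemma dotv0l u : dotv 0 u = 0.
Proof. by rewrite -(scale0r 0) dotvZl mul0r. Qed.

Lemma enorm_ge0 u : 0 <= enorm u.
Proof. exact: sqrtr_ge0. Qed.

Lemma enorm_sqr u : enorm u ^+ 2 = dotv u u.
Proof. by rewrite sqr_sqrtr// dotv_ge0. Qed.

Lemma enorm_le u a : 0 <= a -> (enorm u <= a) = (dotv u u <= a ^+ 2).
Proof. by move=> a0; rewrite -ler_sqr ?nnegrE ?enorm_ge0// enorm_sqr. Qed.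

Lemma enorm_lt u a : 0 <= a -> (enorm u < a) = (dotv u u < a ^+ 2).
Proof. by move=> a0; rewrite -ltr_sqr ?nnegrE ?enorm_ge0// enorm_sqr. Qed.

Lemma le_coord_enorm u i : `|u ord0 i| <= enorm u.
Proof.
rewrite -ler_sqr ?nnegrE ?enorm_ge0// enorm_sqr real_normK ?num_real//.
rewrite /dotv (bigD1 i)//= -expr2 lerDl.
by apply: sumr_ge0 => j _; rewrite -expr2 sqr_ge0.
Qed.

Lemma enorm_le_coord u a : 0 <= a ->
  (forall i, `|u ord0 i| <= a) -> enorm u <= m%:R * a.
Proof.
move=> a0 ua; rewrite enorm_le ?mulr_ge0//.
apply: (@le_trans _ _ (m%:R * a ^+ 2)).
  rewrite -[m in m%:R]card_ord mulr_natl -sumr_const; apply: ler_sum => i _.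
  by rewrite -expr2 -real_normK ?num_real// ler_sqr ?nnegrE// ua.
rewrite exprMn ler_wpM2r ?sqr_ge0//.
by rewrite -natrX ler_nat; case: (m) => // k; exact: (@leq_pexp2l k.+1 1 2).
Qed.

Lemma enorm0 : enorm (0 : 'rV[R]_m) = 0.
Proof. by rewrite /enorm dotv0l sqrtr0. Qed.

Lemma enorm_eq0 u : enorm u = 0 -> u = 0.
Proof.
move=> u0; apply/rowP => i; apply/eqP; rewrite mxE -normr_eq0.
by rewrite eq_le normr_ge0 -u0 le_coord_enorm.
Qed.

Lemma enorm_gt0 u : u != 0 -> 0 < enorm u.
Proof.
by rewrite lt_neqAle enorm_ge0 andbT; apply: contraNN => /eqP/esym/enorm_eq0->.
Qed.

Lemma enormZ a u : enorm (a *: u) = `|a| * enorm u.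
Proof.
by rewrite /enorm dotvZl dotvZr mulrA -expr2 sqrtrM ?sqr_ge0// sqrtr_sqr.
Qed.

Lemma enormN u : enorm (- u) = enorm u.
Proof. by rewrite -scaleN1r enormZ normrN1 mul1r. Qed.

Lemma enormBC u v : enorm (u - v) = enorm (v - u).
Proof. by rewrite -enormN opprB. Qed.

Lemma dotv_sphere u : sphere u -> dotv u u = 1.
Proof. by rewrite /sphere/= -enorm_sqr => ->; rewrite expr1n. Qed.

Lemma sphere_dotv u : dotv u u = 1 -> sphere u.
Proof. by rewrite /sphere/= /enorm => ->; rewrite sqrtr1. Qed.

(** Expanding $|\,|v|u-|u|v\,|^2\ge0$. *)
Lemma cauchy_schwarz u v : dotv u v <= enorm u * enorm v.
Proof.
have [->|u0] := eqVneq u 0; first by rewrite dotv0l enorm0 mul0r.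
have [->|v0] := eqVneq v 0; first by rewrite dotvC dotv0l enorm0 mulr0.
have := dotv_ge0 (enorm v *: u - enorm u *: v).
rewrite !dotvE -!enorm_sqr (dotvC v u).
have /[dup] v1 := enorm_gt0 v0; have /[dup] u1 := enorm_gt0 u0.
set a := enorm u in u1 *; set b := enorm v in v1 * => a0 b0.
set c := dotv u v => h.
have : 0 <= (a * b) * (a * b - c) by nra.
by rewrite pmulr_rge0 ?mulr_gt0// subr_ge0.
Qed.

Lemma dotv_le_enorm u v : sphere v -> dotv u v <= enorm u.
Proof. by move=> v1; have := cauchy_schwarz u v; rewrite v1 mulr1. Qed.

Lemma enormD u v : enorm (u + v) <= enorm u + enorm v.
Proof.
rewrite enorm_le ?addr_ge0 ?enorm_ge0// !dotvE -!enorm_sqr (dotvC v u).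
by have := cauchy_schwarz u v; lra.
Qed.

Lemma enorm_triangle y x z : enorm (x - z) <= enorm (x - y) + enorm (y - z).
Proof. by rewrite -[x - z](subrKA y); exact: enormD. Qed.

Lemma sphere_normalize u : u != 0 -> sphere ((enorm u)^-1 *: u).
Proof.
move=> /enorm_gt0 u0; rewrite /sphere/= enormZ ger0_norm ?invr_ge0 ?enorm_ge0//.
by rewrite mulVf// gt_eqF.
Qed.

End EuclideanSpace.

Section EuclideanTopology.
Context {R : realType} {m : nat}.
Implicit Types (u v w x y : 'rV[R]_m) (a b r : R) (A U : set 'rV[R]_m).

(** The Euclidean norm is equivalent to the sup norm, which defines the topology. *)
Lemma nbhs_eball r x : 0 < r -> nbhs x (eball r x).
Proof.
move=> r0; apply/nbhs_ballP; exists (r / m.+1%:R) => /=; first by rewrite divr_gt0.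
move=> y [_ xy]; rewrite /eball/=.
have c0 : 0 <= r / m.+1%:R by rewrite divr_ge0 ?ltW.
apply: le_trans (enorm_le_coord c0 _) _ => [i|].
  by rewrite !mxE distrC; apply: ltW; exact: xy.
rewrite mulrCA; apply: ler_piMr; first exact: ltW.
by rewrite ler_pdivrMr ?ltr0Sn// mul1r ler_nat.
Qed.

Lemma eball_sub_nbhs A x : nbhs x A -> exists2 r, 0 < r & eball r x `<=` A.
Proof.
move=> /nbhs_ballP[e/= e0 eA]; exists (e / 2); first by rewrite divr_gt0.
move=> y; rewrite /eball/= => xy; apply: eA; split => // i j.
rewrite [i]ord1 /ball/= distrC.
have -> : y ord0 j - x ord0 j = (y - x) ord0 j by rewrite !mxE.
apply: le_lt_trans (le_coord_enorm _ _) _.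
by apply: le_lt_trans xy _; rewrite gtr_pMr// invf_lt1// ltr1n.
Qed.

Lemma open_eballP A :
  open A <-> forall x, A x -> exists2 r, 0 < r & eball r x `<=` A.
Proof.
split; first by rewrite openE => oA x /oA /eball_sub_nbhs.
move=> h; rewrite openE => x /h[r r0 rA]; apply: filterS rA _.
exact: nbhs_eball.
Qed.

Lemma closure_eballP A x :
  closure A x <-> forall r, 0 < r -> exists2 y, A y & enorm (y - x) <= r.
Proof.
split=> [cA r r0|h B /eball_sub_nbhs[r r0 rB]].
  by have [y [Ay xy]] := cA _ (nbhs_eball x r0); exists y.
by have [y Ay xy] := h _ r0; exists y; split => //; exact: rB.
Qed.

Lemma bounded_enorm A : bounded_set A ->
  exists2 M, 0 < M & forall x, A x -> enorm x <= M.
Proof.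
move=> [M [_ hM]]; have hM1 := hM (`|M| + 1).
have {}hM1 : forall x, A x -> `|x| <= `|M| + 1.
  by apply: hM1; rewrite (le_lt_trans (ler_norm _))// ltrDl.
have M0 : 0 <= `|M| + 1 by rewrite addr_ge0.
exists (m%:R * (`|M| + 1) + 1); first by rewrite ltr_wpDl// mulr_ge0.
move=> x /hM1 xM.
apply: (le_trans (enorm_le_coord M0 _)); last by rewrite lerDl.
move=> i; apply: le_trans xM.
rewrite [leRHS]/Num.norm/= mx_normrE; apply/bigmax_geP; right => /=.
by exists (ord0, i).
Qed.

Lemma enorm_bounded A M : (forall x, A x -> enorm x <= M) -> bounded_set A.
Proof.
move=> hM; exists `|M|; split; first exact: num_real.
move=> N MN x Ax /=; rewrite [leLHS]/Num.norm/= mx_normrE; apply/bigmax_leP; split.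
  by rewrite (le_trans _ (ltW MN)).
move=> [i j] _ /=; rewrite [i]ord1; apply: le_trans (le_coord_enorm _ _) _.
exact: le_trans (hM _ Ax) (le_trans (ler_norm _) (ltW MN)).
Qed.

End EuclideanTopology.

(** * Measurability in Euclidean space *)

Section MeasurableEuclidean.
Context {R : realType} {m : nat}.
Implicit Types (u v w x y c : 'rV[R]_m) (a b r s : R) (A U : set 'rV[R]_m).

Definition box c s : set 'rV[R]_m :=
  [set x | forall i, `|x ord0 i - c ord0 i| <= s].

Lemma measurable_box c s : measurable (box c s).
Proof.
have -> : box c s = \bigcap_(i in [set: 'I_m])
    ((fun x : 'rV[R]_m => x ord0 i : measurableTypeR R) @^-1`
      `[c ord0 i - s, c ord0 i + s]).
  by apply/seteqP; split=> x /= h i => [_|]; have := h i;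
    rewrite /= in_itv/= ler_distl//; apply.
apply: fin_bigcap_measurable => // i _.
by rewrite -[X in measurable X]setTI; exact: measurable_coord.
Qed.

(** The boxes with rational centers and radii $1/(n+1)$ form a countable basis. *)
Lemma measurable_open A : open A -> measurable A.
Proof.
move=> oA.
pose F (p : 'rV[rat]_m * nat) : set 'rV[R]_m :=
  let B := box (map_mx ratr p.1) p.2.+1%:R^-1 in
  if `[< B `<=` A >] then B else set0.
suff -> : A = \bigcup_p F p.
  apply: countable_bigcupT_measurable => [|p]; first exact: countableP.
  by rewrite /F; case: ifP => _; [exact: measurable_box|exact: measurable0].
apply/seteqP; split=> x; last first.
  by move=> [p _]; rewrite /F; case: ifP => // /asboolP; apply.
move=> /(open_eballP A).1 -/(_ oA)[r r0 rA].
pose n := Num.bound (m%:R * 2 / r).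
have nr : m%:R * (2 / n.+1%:R) <= r.
  rewrite mulrA ler_pdivrMr ?ltr0Sn// [leRHS]mulrC -ler_pdivrMr//.
  have /archi_boundP/ltW/le_trans : 0 <= m%:R * 2 / r.
    by rewrite divr_ge0 ?mulr_ge0// ltW.
  by apply; rewrite ler_nat leqnSn.
have /fin_all_exists[q hq] i : exists q : rat,
    `|x ord0 i - ratr q| <= n.+1%:R^-1.
  have [|q] := @rat_in_itvoo R (x ord0 i - n.+1%:R^-1) (x ord0 i + n.+1%:R^-1).
    by rewrite ltrD2l gtrN// invr_gt0.
  by rewrite in_itv/= -ltr_distl => /ltW qx; exists q; rewrite distrC.
exists (\row_i q i, n) => //; rewrite /F/=.
have xB : box (map_mx ratr (\row_i q i)) n.+1%:R^-1 x.
  by move=> i; rewrite !mxE hq.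
case: asboolP => // /existsNP[] y; apply/not_implyP => -[].
move=> By; apply; apply: rA; rewrite /eball/=; apply: le_trans nr.
apply: enorm_le_coord => [|i]; first by rewrite divr_ge0.
have -> : (y - x) ord0 i = (y ord0 i - ratr (q i)) - (x ord0 i - ratr (q i)).
  by rewrite !mxE; ring.
apply: le_trans (ler_normB _ _) _; rewrite mulr_natl mulr2n lerD ?hq//.
by have := By i; rewrite !mxE.
Qed.

Lemma measurable_closed A : closed A -> measurable A.
Proof.
move=> cA; rewrite -[A]setCK; apply: measurableC; apply: measurable_open.
exact: closed_openC.
Qed.

Lemma measurable_dotv d (T : measurableType d) (D : set T) (f g : T -> 'rV[R]_m) :
  measurable_fun D f -> measurable_fun D g ->
  measurable_fun D (fun t => dotv (f t) (g t)).
Proof.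
move=> mf mg; apply: measurable_sum => i; apply: measurable_funM.
  exact: (measurableT_comp (measurable_coord i) mf).
exact: (measurableT_comp (measurable_coord i) mg).
Qed.

Lemma measurable_enorm : measurable_fun setT (@enorm R m).
Proof.
rewrite (_ : @enorm R m = Num.sqrt \o (fun u => dotv u u))//.
apply: measurableT_comp.
  by apply: continuous_measurable_fun; exact: sqrt_continuous.
exact: measurable_dotv.
Qed.

End MeasurableEuclidean.

(** * Translations and boxes *)

Section LebesgueBasics.
Context {R : realType}.
Local Open Scope ereal_scope.

Lemma lebesgue_measure_shift (c : R) (A : set (measurableTypeR R)) :
  measurable A ->
  pushforward lebesgue_measure
    ((fun x => x + c)%R : measurableTypeR R -> measurableTypeR R) A =
  lebesgue_measure A.
Proof.
move=> mA; have mS : measurable_fun setT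
    ((fun x => x + c)%R : measurableTypeR R -> measurableTypeR R).
  by apply: measurable_funD.
apply/esym/lebesgue_measure_unique => //= _ [[a b]] _ <-.
rewrite /pushforward.
have -> : (fun x : R => (x + c)%R) @^-1` [set` `]a, b]] =
  [set` `](a - c)%R, (b - c)%R]].
  by apply/seteqP; split=> x /=; rewrite !in_itv/= ltrBlDr lerBrDr.
by rewrite !lebesgue_measure_itv/= !lte_fin ltrD2r -!EFinB;
  congr (if _ then _%:E else _); ring.
Qed.


Lemma rV_cons0 n (a : R) (y : 'rV[R]_n) : @rV_cons R n (a, y) ord0 ord0 = a.
Proof.
rewrite /rV_cons.
have -> : ord0 = lshift n (ord0 : 'I_1) :> 'I_(1 + n) by apply: val_inj.
exact: (etrans (@row_mxEl _ 1 1 n (const_mx a) y _ _) (mxE _ _ _ _)).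
Qed.

Lemma rV_consS n (a : R) (y : 'rV[R]_n) (i : 'I_n) :
  @rV_cons R n (a, y) ord0 (rshift 1 i : 'I_(1 + n)) = y ord0 i.
Proof. exact: (@row_mxEr _ 1 1 n (const_mx a) y). Qed.

Lemma ord_rV_cons n (P : 'I_n.+1 -> Prop) :
  P ord0 -> (forall j : 'I_n, P (rshift 1 j : 'I_(1 + n))) -> forall i, P i.
Proof.
move=> P0 PS i; case: (splitP (i : 'I_(1 + n))) => j ij.
  by have -> : i = ord0 by apply: val_inj; rewrite /= ij ord1.
by have -> : i = rshift 1 j by exact: val_inj.
Qed.

Lemma rV_consD n (a b : R) (x y : 'rV[R]_n) :
  (rV_cons (a, x) + rV_cons (b, y) = @rV_cons R n (a + b, x + y))%R.
Proof.
apply/rowP; apply: ord_rV_cons => [|i]; rewrite mxE ?rV_cons0 ?rV_consS//.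
by rewrite mxE.
Qed.

Lemma rV_cons_surj n (x : 'rV[R]_n.+1) : exists a y, x = @rV_cons R n (a, y).
Proof.
exists (x ord0 ord0), (@rsubmx _ 1 1 n x).
apply/rowP; apply: ord_rV_cons => [|i].
  by rewrite rV_cons0.
by rewrite rV_consS mxE.
Qed.

Lemma measurable_rV_cons_preimage n (A : set 'rV[R]_n.+1) :
  measurable A -> measurable (@rV_cons R n @^-1` A).
Proof. by move=> mA; rewrite -[X in measurable X]setTI; apply: measurable_rV_cons. Qed.

Lemma lebesgue_rVSE n (A : set 'rV[R]_n.+1) :
  lebesgue_rV n.+1 A =
  \int[lebesgue_measure]_a lebesgue_rV n [set y | A (rV_cons (a, y))].
Proof.
rewrite /= /pushforward; apply: eq_integral => a _ /=; congr (lebesgue_rV n _).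
by apply/seteqP; split => y; rewrite /xsection/= inE.
Qed.

Lemma measurable_slice n (A : set 'rV[R]_n.+1) (a : R) :
  measurable A -> measurable [set y | A (@rV_cons R n (a, y))].
Proof.
move=> /measurable_rV_cons_preimage mA.
rewrite (_ : [set _ | _] = xsection (@rV_cons R n @^-1` A) a).
  exact: measurable_xsection.
by apply/seteqP; split => y; rewrite /xsection/= inE.
Qed.

Lemma measurable_lebesgue_slice n (A : set 'rV[R]_n.+1) : measurable A ->
  measurable_fun setT (fun a : measurableTypeR R =>
    lebesgue_rV n [set y | A (rV_cons (a, y))]).
Proof.
move=> /measurable_rV_cons_preimage mA.
rewrite (_ : (fun _ => _) = @lebesgue_rV R n \o xsection (@rV_cons R n @^-1` A)).
  exact: measurable_fun_xsection.
apply/funext => a /=; congr (lebesgue_rV n _).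
by apply/seteqP; split => y; rewrite /xsection/= inE.
Qed.

Lemma measurable_shift n (c : 'rV[R]_n) :
  measurable_fun setT (fun x : 'rV[R]_n => x + c)%R.
Proof.
apply: measurable_rVP => i.
rewrite (_ : (fun _ => _) = (fun x : 'rV[R]_n => x ord0 i + c ord0 i)%R).
  by apply: measurable_funD => //; exact: measurable_coord.
by apply/funext => x; rewrite mxE.
Qed.

(** Fubini reduces translation invariance to dimension one: translate the slices by
induction, then the first coordinate. *)
Lemma lebesgue_rV_shift n (c : 'rV[R]_n) (A : set 'rV[R]_n) : measurable A ->
  lebesgue_rV n ((fun x => x + c)%R @^-1` A) = lebesgue_rV n A.
Proof.
elim: n => [|n IH] in c A *.
  move=> _; congr (lebesgue_rV 0 _); apply/seteqP.
  by split => x /=; rewrite [c]thinmx0 addr0.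
move=> mA; have [c0 [c' ->]] := rV_cons_surj c; rewrite !lebesgue_rVSE.
pose G (a : measurableTypeR R) := lebesgue_rV n [set y | A (rV_cons (a, y))].
transitivity (\int[lebesgue_measure]_a G (a + c0)%R).
  apply: eq_integral => a _ /=.
  rewrite /G -[RHS](IH c'); last exact: measurable_slice.
  by congr (lebesgue_rV n _); apply/seteqP; split => y /=; rewrite rV_consD.
have mS : measurable_fun setT
    ((fun x => x + c0)%R : measurableTypeR R -> measurableTypeR R).
  exact: measurable_funD.
have -> : \int[lebesgue_measure]_a G a =
    \int[pushforward lebesgue_measure ((fun x => x + c0)%R :
      measurableTypeR R -> measurableTypeR R)]_a G a.
  by apply: eq_measure_integral => //= B mB _; rewrite lebesgue_measure_shift.
by rewrite ge0_integral_pushforward//; exact: measurable_lebesgue_slice.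
Qed.

(** Only the slices over $[a-s,a+s]$ are nonempty, and these are boxes again. *)
Lemma lebesgue_rV_box n (c : 'rV[R]_n) (s : R) : (0 <= s)%R ->
  lebesgue_rV n (box c s) = ((s *+ 2) ^+ n)%:E.
Proof.
move=> s0; elim: n => [|n IH] in c *.
  rewrite (_ : box c s = setT) ?expr0.
    by rewrite /= diracT.
  by apply/seteqP; split => // x _ [].
have [a [y ->]] := rV_cons_surj c; rewrite lebesgue_rVSE.
transitivity (\int[lebesgue_measure]_x
    ((\1_(`[(a - s)%R, (a + s)%R]%classic : set (measurableTypeR R)) x)%:E *
     ((s *+ 2) ^+ n)%:E)).
  apply: eq_integral => x _ /=; rewrite indicE.
  have [|xa] := boolP (x \in _); rewrite ?mul1e ?mul0e.
    rewrite inE/= in_itv/= -ler_distl => xa; rewrite -(IH y); congr (lebesgue_rV n _).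
    apply/seteqP; split => z /= zb.
      by move=> i; have := zb (rshift 1 i : 'I_(1 + n)); rewrite !rV_consS.
    by apply: ord_rV_cons => [|i]; rewrite ?rV_cons0// !rV_consS.
  rewrite (_ : [set _ | _] = set0) ?measure0//; apply/seteqP; split => // z /=.
  move=> /(_ ord0); rewrite !rV_cons0 ler_distl => h; move: xa.
  by rewrite notin_setE/= in_itv/= h.
rewrite ge0_integralZr//; first last.
- by rewrite lee_fin exprn_ge0// mulrn_wge0.
- by apply/measurable_EFinP; exact: measurable_indic.
rewrite integral_indic// setIT.
rewrite [X in X * _](_ : _ = lebesgue_measure `[(a - s)%R, (a + s)%R])//.
rewrite lebesgue_measure_itv/= lte_fin.
have [s_gt0|] := ltP 0%R s.
  rewrite ifT; last lra.
  by rewrite -EFinB -EFinM exprS; congr (_ * _)%:E; rewrite mulr2n; ring.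
move=> s_le0; have -> : s = 0%R by apply/eqP; rewrite eq_le s0 s_le0.
by rewrite subr0 addr0 ltxx mul0e mul0rn exprS mul0r.
Qed.

End LebesgueBasics.

(** * Measure-preserving isometries *)

Section MeasureOfBalls.
Context {R : realType} {m : nat}.
Implicit Types (x y c : 'rV[R]_m) (r s : R).
Local Open Scope ereal_scope.

Lemma eball_closed r x : closed (eball r x).
Proof.
rewrite -[eball r x]setCK; apply: open_closedC; apply/open_eballP => y /=.
rewrite /eball/= => /negP; rewrite -ltNge => xy.
exists ((enorm (y - x) - r) / 2)%R; first by rewrite divr_gt0// subr_gt0.
move=> z; rewrite /eball/= => yz xz.
have := enorm_triangle z y x; rewrite (enormBC y z); lra.
Qed.

Lemma measurable_eball r x : measurable (eball r x).
Proof. by apply: measurable_closed; exact: eball_closed. Qed.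

Lemma lebesgue_eball_lty r x : lebesgue_rV m (eball r x) < +oo.
Proof.
have [r0|r0] := ltP r 0%R.
  rewrite (_ : eball r x = set0) ?measure0//.
  apply/seteqP; split => // y; rewrite /eball/= => /le_lt_trans/(_ r0).
  by rewrite ltNge enorm_ge0.
apply: (@le_lt_trans _ _ (lebesgue_rV m (box x r))).
  apply: le_measure; rewrite ?inE.
  - exact: measurable_eball.
  - exact: measurable_box.
  - move=> y; rewrite /eball/= => yx i; apply: le_trans yx.
    by have := le_coord_enorm (y - x) i; rewrite !mxE.
by rewrite lebesgue_rV_box// ltry.
Qed.

Lemma lebesgue_eball_ge r x : (0 <= r)%R ->
  ((r / m.+1%:R *+ 2) ^+ m)%:E <= lebesgue_rV m (eball r x).
Proof.
move=> r0; rewrite -(lebesgue_rV_box x); last by rewrite divr_ge0.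
apply: le_measure; rewrite ?inE.
- exact: measurable_box.
- exact: measurable_eball.
move=> y yx; rewrite /eball/=.
have c0 : (0 <= r / m.+1%:R)%R by rewrite divr_ge0.
apply: le_trans (enorm_le_coord c0 _) _ => [i|]; first by rewrite !mxE; exact: yx.
rewrite mulrCA; apply: ler_piMr => //.
by rewrite ler_pdivrMr ?ltr0Sn// mul1r ler_nat.
Qed.

Lemma lebesgue_eball_gt0 r x : (0 < r)%R -> 0 < lebesgue_rV m (eball r x).
Proof.
move=> r0; apply: lt_le_trans (lebesgue_eball_ge x (ltW r0)).
by rewrite lte_fin exprn_gt0// mulrn_wgt0// divr_gt0.
Qed.

End MeasureOfBalls.

Section Preserving.
Context {R : realType} {m : nat}.
Implicit Types (x y c : 'rV[R]_m) (T : 'rV[R]_m -> 'rV[R]_m).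
Local Open Scope ereal_scope.

Definition preserves_lebesgue T := measurable_fun setT T /\
  forall A, measurable A -> lebesgue_rV m (T @^-1` A) = lebesgue_rV m A.

Lemma preserves_shift c : preserves_lebesgue (fun x => x + c)%R.
Proof. by split; [exact: measurable_shift|exact: lebesgue_rV_shift]. Qed.

Lemma preserves_comp T T' :
  preserves_lebesgue T -> preserves_lebesgue T' -> preserves_lebesgue (T \o T').
Proof.
move=> [mT hT] [mT' hT']; split; first exact: measurableT_comp.
move=> A mA; rewrite comp_preimage hT' ?hT//.
by rewrite -[X in measurable X]setTI; exact: mT.
Qed.

Lemma ge0_integral_preserving T (D : set 'rV[R]_m) (f : 'rV[R]_m -> \bar R) :
  preserves_lebesgue T -> measurable D -> measurable_fun setT f ->
  (forall x, 0 <= f x) ->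
  \int[lebesgue_rV m]_(x in T @^-1` D) f (T x) =
  \int[lebesgue_rV m]_(x in D) f x.
Proof.
move=> [mT hT] mD mf f0.
transitivity (\int[pushforward (lebesgue_rV m) T]_(x in D) f x).
  by rewrite ge0_integral_pushforward//; exact: measurable_funTS.
by apply: eq_measure_integral => //= A mA _; rewrite -hT.
Qed.

Lemma integral_slice (S : set ('rV[R]_m * 'rV[R]_m)) : measurable S ->
  \int[lebesgue_rV m]_x lebesgue_rV m [set y | S (x, y)] =
  \int[lebesgue_rV m]_y lebesgue_rV m [set x | S (x, y)].
Proof.
move=> mS; pose f z := (\1_S z)%:E : \bar R.
have mf : measurable_fun setT f by apply/measurable_EFinP; exact: measurable_indic.
have f0 z : 0 <= f z by rewrite lee_fin.
transitivity (\int[lebesgue_rV m]_x \int[lebesgue_rV m]_y f (x, y)).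
  apply: eq_integral => x _.
  have -> : (fun y => f (x, y)) = (fun y => (\1_[set y | S (x, y)] y)%:E).
    by apply/funext => y; rewrite /f !indicE; congr ((_ : bool)%:R%:E).
  rewrite integral_indic ?setIT//.
  rewrite (_ : [set _ | _] = xsection S x); first exact: measurable_xsection.
  by apply/seteqP; split => y; rewrite /xsection/= inE.
rewrite fubini_tonelli//; apply: eq_integral => y _.
have -> : (fun x => f (x, y)) = (fun x => (\1_[set x | S (x, y)] x)%:E).
  by apply/funext => x; rewrite /f !indicE; congr ((_ : bool)%:R%:E).
rewrite integral_indic ?setIT//.
rewrite (_ : [set _ | _] = ysection S y); first exact: measurable_ysection.
by apply/seteqP; split => x; rewrite /ysection/= inE.
Qed.

(** Weil's uniqueness argument for translation invariant measures, applied to the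
Lebesgue measure and its image under $T$. Let $B$ be the unit ball. Evaluating
$\int\!\!\int 1_B(y)\,1_A(Tx+y)$ in one order gives $\lambda(T^{-1}A)\,\lambda(B)$. After
the translation of $y$ by $-Tx$ the other order gives $\lambda(A)\,\lambda(B)$, because
$T^{-1}$ maps balls to balls. *)
Lemma preserves_isometry T : measurable_fun setT T ->
  {morph T : x y / (x + y)%R} -> (forall x, enorm (T x) = enorm x) ->
  (forall y, exists x, T x = y) -> preserves_lebesgue T.
Proof.
move=> mT TD Tn Ts; split => // A mA.
have TN x : T (- x)%R = (- T x)%R.
  have T0 : T 0%R = 0%R by apply: (addIr (T 0)%R); rewrite -TD !add0r.
  by apply: (addIr (T x)); rewrite -TD !addNr.
have mpre f (D : set 'rV[R]_m) : measurable_fun setT f -> measurable D ->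
    measurable ((f : 'rV[R]_m -> 'rV[R]_m) @^-1` D).
  by move=> mf mD; rewrite -[X in measurable X]setTI; exact: mf.
have mpre2 f (D : set 'rV[R]_m) : measurable_fun setT f -> measurable D ->
    measurable ((f : 'rV[R]_m * 'rV[R]_m -> 'rV[R]_m) @^-1` D).
  by move=> mf mD; rewrite -[X in measurable X]setTI; exact: mf.
pose B := eball 1%R (0 : 'rV[R]_m)%R.
have mB : measurable B by exact: measurable_eball.
have mD : measurable_fun setT
    (fun z : 'rV[R]_m * 'rV[R]_m => T z.1 + z.2)%R.
  apply: measurable_rVP => i; rewrite (_ : (fun _ => _) =
    (fun z : 'rV[R]_m * 'rV[R]_m => T z.1 ord0 i + z.2 ord0 i)%R); last first.
    by apply/funext => z; rewrite mxE.
  apply: measurable_funD.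
    apply: (measurableT_comp (measurable_coord i)).
    exact: (measurableT_comp mT measurable_fst).
  exact: (measurableT_comp (measurable_coord i) measurable_snd).
have mBf : measurable_fun setT
    (fun z : 'rV[R]_m * 'rV[R]_m => z.2 - T z.1)%R.
  apply: measurable_rVP => i; rewrite (_ : (fun _ => _) =
    (fun z : 'rV[R]_m * 'rV[R]_m => z.2 ord0 i - T z.1 ord0 i)%R); last first.
    by apply/funext => z; rewrite !mxE.
  apply: measurable_funB.
    exact: (measurableT_comp (measurable_coord i) measurable_snd).
  apply: (measurableT_comp (measurable_coord i)).
  exact: (measurableT_comp mT measurable_fst).
have cst_slice (C : set 'rV[R]_m) (k : \bar R)
    (F : 'rV[R]_m -> set 'rV[R]_m) : measurable C -> 0 <= k ->
    (forall y, lebesgue_rV m (F y) = k) ->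
    \int[lebesgue_rV m]_y lebesgue_rV m [set x | C y /\ F y x] =
      k * lebesgue_rV m C.
  move=> mC k0 hF.
  transitivity (\int[lebesgue_rV m]_y (k * (\1_C y)%:E)).
    apply: eq_integral => y _; rewrite indicE.
    have [/set_mem yC|/negP yC] := boolP (y \in C).
      rewrite mule1 -(hF y); congr (lebesgue_rV m _).
      by apply/seteqP; split => x /= => [[]|].
    rewrite mule0 (_ : [set _ | _] = set0) ?measure0//.
    by apply/seteqP; split => // x /= [/mem_set].
  rewrite ge0_integralZl// ?integral_indic ?setIT//.
  by apply/measurable_EFinP; exact: measurable_indic.
have E1 : \int[lebesgue_rV m]_x lebesgue_rV m [set y | B y /\ A (T x + y)%R] =
    lebesgue_rV m (T @^-1` A) * lebesgue_rV m B.
  rewrite (@integral_slice [set z | B z.2 /\ A (T z.1 + z.2)%R]).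
    apply: (cst_slice B _ (fun y => [set x | A (T x + y)%R])) => // y.
    have [d <-] := Ts y.
    rewrite -(lebesgue_rV_shift d (mpre _ _ mT mA)).
    by congr (lebesgue_rV m _); apply/seteqP; split => x /=; rewrite TD.
  apply: measurableI; [exact: (mpre2 _ _ measurable_snd mB)|exact: mpre2].
have E2 : \int[lebesgue_rV m]_x lebesgue_rV m [set y | B y /\ A (T x + y)%R] =
    lebesgue_rV m B * lebesgue_rV m A.
  transitivity (\int[lebesgue_rV m]_x
      lebesgue_rV m [set y | A y /\ B (y - T x)%R]).
    apply: eq_integral => x _.
    rewrite -(lebesgue_rV_shift (T x) (A := [set y | A y /\ B (y - T x)%R])).
      congr (lebesgue_rV m _); apply/seteqP; split => y /=.
        by rewrite addrK addrC => -[].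
      by rewrite addrK addrC => -[].
    apply: measurableI => //.
    by apply: (mpre (fun y => y + - T x)%R) => //; exact: measurable_shift.
  rewrite (@integral_slice [set z | A z.2 /\ B (z.2 - T z.1)%R]).
    apply: (cst_slice A _ (fun y => [set x | B (y - T x)%R])) => // y.
    have [d <-] := Ts y.
    rewrite -(lebesgue_rV_shift (- d)%R mB).
    congr (lebesgue_rV m _); apply/seteqP; split => x /=;
      by rewrite /B /eball/= !subr0 -TN -TD Tn enormBC.
  apply: measurableI; [exact: (mpre2 _ _ measurable_snd mA)|exact: mpre2].
have /fineK Bfin : lebesgue_rV m B \is a fin_num.
  by rewrite ge0_fin_numE// lebesgue_eball_lty.
have B0 : (0 < fine (lebesgue_rV m B))%R.
  by rewrite -lte_fin Bfin lebesgue_eball_gt0.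
move: E1; rewrite E2 muleC => /esym.
move=> /(congr1 (fun z => z * (fine (lebesgue_rV m B))^-1%:E)).
by rewrite -Bfin -!muleA -EFinM divff ?gt_eqF// !mule1.
Qed.

Lemma reflK v b : sphere v -> involutive (@refl R m v b).
Proof.
move=> /dotv_sphere v1 x; rewrite /refl !dotvE v1.
apply/rowP => i; rewrite !mxE; ring.
Qed.

Lemma measurable_refl v b : measurable_fun setT (@refl R m v b).
Proof.
apply: measurable_rVP => i; rewrite (_ : (fun _ => _) = (fun x : 'rV[R]_m =>
    x ord0 i - 2 * (dotv x v - b) * v ord0 i)%R); last first.
  by apply/funext => x; rewrite !mxE.
apply: measurable_funB; first exact: measurable_coord.
apply: measurable_funM => //; apply: measurable_funM => //.
by apply: measurable_funB => //; exact: measurable_dotv.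
Qed.

Lemma enorm_refl0 v x : sphere v -> enorm (refl v 0 x) = enorm x.
Proof.
move=> /dotv_sphere v1; rewrite /enorm /refl !dotvE v1; congr Num.sqrt.
rewrite (dotvC v x); ring.
Qed.

Lemma preserves_refl v b : sphere v -> preserves_lebesgue (refl v b).
Proof.
move=> v1; have h0 : preserves_lebesgue (refl v 0).
  apply: preserves_isometry.
  - exact: measurable_refl.
  - by move=> x y; rewrite /refl !dotvE; apply/rowP => i; rewrite !mxE; ring.
  - by move=> x; exact: enorm_refl0.
  - by move=> y; exists (refl v 0 y); rewrite reflK.
rewrite (_ : refl v b = (fun x => x + (2 * b) *: v)%R \o refl v 0).
  by apply: preserves_comp h0; exact: preserves_shift.
by apply/funext => x /=; rewrite /refl; apply/rowP => i; rewrite !mxE; ring.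
Qed.

End Preserving.

(** * Reflections and the minimal unfolded region *)

Section IntegralComparison.
Context d (T : measurableType d) (R : realType).
Variable mu : {measure set T -> \bar R}.
Local Open Scope ereal_scope.

(** The integral of the positive function $f-g$ over $N$ vanishes. *)
Lemma measure0_integral_le (N : set T) (f g : T -> R) :
  measurable N -> measurable_fun setT f -> measurable_fun setT g ->
  (forall x, 0 <= g x)%R -> (forall x, N x -> g x < f x)%R ->
  \int[mu]_(x in N) (g x)%:E < +oo ->
  \int[mu]_(x in N) (f x)%:E <= \int[mu]_(x in N) (g x)%:E -> mu N = 0.
Proof.
move=> mN mf mg g0 gf goo fg.
have mfg : measurable_fun N (fun x => (f x - g x)%:E).
  by apply/measurable_EFinP; apply: measurable_funTS; exact: measurable_funB.
have ifg : \int[mu]_(x in N) `|(f x - g x)%:E| = 0.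
  rewrite (eq_integral (fun x => (f x - g x)%:E)); last first.
    by move=> x /set_mem xN; rewrite gee0_abs// lee_fin subr_ge0 ltW// gf.
  apply/eqP; rewrite eq_le; apply/andP; split; last first.
    by apply: integral_ge0 => x xN; rewrite lee_fin subr_ge0 ltW// gf.
  have gfin : \int[mu]_(x in N) (g x)%:E \is a fin_num.
    by rewrite ge0_fin_numE// integral_ge0// => x _; rewrite lee_fin.
  rewrite -(leeD2rE _ _ gfin) add0e; apply: le_trans fg.
  rewrite -ge0_integralD//.
  - rewrite le_eqVlt; apply/orP; left; apply/eqP; apply: eq_integral => x _.
    by rewrite -EFinD subrK.
  - by move=> x xN; rewrite lee_fin subr_ge0 ltW// gf.
  - by move=> x xN; rewrite lee_fin.
  - by apply/measurable_EFinP; exact: measurable_funTS.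
have [Z [mZ Z0 NZ]] := (ae_eq_integral_abs mu mN mfg).1 ifg.
apply: (subset_measure0 mN mZ _ Z0) => x xN; apply: NZ => /= /(_ xN)[].
by move=> /eqP; rewrite subr_eq0 gt_eqF// gf.
Qed.

End IntegralComparison.

Section Decay.
Context {R : realType} {m : nat}.
Implicit Types (x y u v : 'rV[R]_m) (h : R).

Definition decay h u : R := (enorm u ^+ 2 + h ^+ 2) `^ (- (m.+1%:R / 2)).

Lemma measurable_decay h x :
  measurable_fun setT (fun xi : 'rV[R]_m => decay h (x - xi)).
Proof.
apply: (measurableT_comp (measurable_powR _)).
apply: measurable_funD => //; apply: measurable_funX.
apply: (measurableT_comp measurable_enorm).
rewrite (_ : (fun _ => _) = (fun xi : 'rV[R]_m => xi + x) \o (-%R)).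
  apply: measurableT_comp; first exact: measurable_shift.
  apply: measurable_rVP => i.
  rewrite (_ : (fun _ => _) = (fun t : 'rV[R]_m => - (t ord0 i))).
    by apply: measurable_funN; exact: measurable_coord.
  by apply/funext => t; rewrite mxE.
by apply/funext => t /=; rewrite addrC.
Qed.

Lemma decay_ge0 h u : 0 <= decay h u.
Proof. exact: powR_ge0. Qed.

Lemma powRN_lt (a b e : R) : 0 < e -> 0 < a -> a < b -> b `^ (- e) < a `^ (- e).
Proof.
move=> e0 a0 ab; have b0 := lt_trans a0 ab.
by rewrite !powRN ltf_pV2 ?posrE ?powR_gt0// gt0_ltr_powR ?nnegrE ?ltW.
Qed.

Lemma decay_lt h u v : 0 < h -> enorm u < enorm v -> decay h v < decay h u.
Proof.
move=> h0 uv; apply: powRN_lt; first by rewrite divr_gt0.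
  by rewrite ltr_wpDl ?sqr_ge0// exprn_gt0.
by rewrite ltrD2r ltr_sqr ?nnegrE ?enorm_ge0.
Qed.

Lemma decay_le h u v : 0 < h -> enorm u <= enorm v -> decay h v <= decay h u.
Proof.
rewrite le_eqVlt => h0 /orP[/eqP|uv]; last exact/ltW/decay_lt.
by rewrite /decay => ->.
Qed.

End Decay.

(** The solid angle without its factor $h$, which does not affect the maxima. *)
HB.lock Definition light {R : realType} {m : nat} (A : set 'rV[R]_m) (h : R)
    (x : 'rV[R]_m) : \bar R :=
  (\int[lebesgue_rV m]_(xi in A) (decay h (x - xi))%:E)%E.

Section Light.
Context {R : realType} {m : nat}.
Implicit Types (A B : set 'rV[R]_m) (x : 'rV[R]_m) (h r : R).
Local Open Scope ereal_scope.

Lemma lightE A h x :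
  light A h x = \int[lebesgue_rV m]_(xi in A) (decay h (x - xi))%:E.
Proof. by rewrite light.unlock. Qed.

Lemma light_center A h x : (0 < h)%R -> illuminating_center A h x ->
  forall y, light A h y <= light A h x.
Proof. by move=> h0 xA y; have := xA y; rewrite /solid_angle !lightE lee_pmul2l. Qed.

Lemma light_ge0 A h x : 0 <= light A h x.
Proof. by rewrite lightE; apply: integral_ge0 => xi _; rewrite lee_fin decay_ge0. Qed.

Lemma light_lty A h x r : (0 < h)%R -> measurable A ->
  A `<=` eball r 0%R -> light A h x < +oo.
Proof.
move=> h0 mA AB; rewrite lightE.
apply: (@le_lt_trans _ _ (\int[lebesgue_rV m]_(xi in A) (decay h (0%R : 'rV[R]_m))%:E)).
  apply: (ge0_le_integral _ mA).
  - by move=> xi _; rewrite lee_fin decay_ge0.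
  - by apply/measurable_EFinP/measurable_funTS; exact: measurable_decay.
  - exact: measurable_cst.
  - by move=> xi _; rewrite lee_fin decay_le// enorm0 enorm_ge0.
rewrite [ltLHS](_ : _ = (decay h (0%R : 'rV[R]_m))%:E * lebesgue_rV m A); last first.
  exact: integral_cst.
rewrite lte_mul_pinfty ?lee_fin ?decay_ge0//.
apply: le_lt_trans (lebesgue_eball_lty r (0 : 'rV[R]_m)%R).
by apply: le_measure; rewrite ?inE//; exact: measurable_eball.
Qed.

Lemma light_setU A B h x : measurable A -> measurable B ->
  [disjoint A & B] -> light (A `|` B) h x = light A h x + light B h x.
Proof.
move=> mA mB AB; rewrite !lightE ge0_integral_setU//.
  by apply/measurable_EFinP/measurable_funTS; exact: measurable_decay.
by move=> xi _; rewrite lee_fin decay_ge0.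
Qed.

Lemma le_light A B h x : measurable A -> measurable B ->
  A `<=` B -> light A h x <= light B h x.
Proof.
move=> mA mB AB; rewrite !lightE; apply: ge0_subset_integral => //.
  by apply/measurable_EFinP/measurable_funTS; exact: measurable_decay.
by move=> xi _; rewrite lee_fin decay_ge0.
Qed.

End Light.

Section Reflection.
Context {R : realType} {m : nat}.
Implicit Types (x y u v : 'rV[R]_m) (A : set 'rV[R]_m).

Lemma enorm_refl v b x y : sphere v ->
  enorm (refl v b x - refl v b y) = enorm (x - y).
Proof.
move=> v1; rewrite -(enorm_refl0 (x - y) v1); congr enorm; rewrite /refl !dotvE.
by apply/rowP => i; rewrite !mxE; ring.
Qed.

Lemma enorm_reflB v b x y : sphere v -> b < dotv x v -> dotv y v < b ->
  enorm (refl v b x - y) < enorm (x - y).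
Proof.
move=> v1 bx yb; rewrite enorm_lt ?enorm_ge0// enorm_sqr /refl.
have := dotv_sphere v1; rewrite !dotvE => ->.
rewrite (dotvC v x) (dotvC v y) (dotvC y x).
set a := dotv x v in bx *; set c := dotv y v in yb *.
suff : 0 < (a - b) * (b - c) by lra.
by rewrite mulr_gt0// subr_gt0.
Qed.

Definition reflects_into v b A :=
  forall y, A y -> b <= dotv y v -> A (refl v b y).

Lemma light_symmetric A h x v b : sphere v -> measurable A ->
  refl v b @^-1` A = A -> light A h (refl v b x) = light A h x.
Proof.
move=> v1 mA SA.
have := ge0_integral_preserving (f := fun z => (decay h (refl v b x - z))%:E)
  (preserves_refl b v1) mA.
rewrite SA !lightE => <-.
- by apply: eq_integral => z _; rewrite /decay enorm_refl.
- by apply/measurable_EFinP; exact: measurable_decay.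
- by move=> z; rewrite lee_fin decay_ge0.
Qed.

(** Put $R=\mathrm{Refl}_{v,b}$. The part $M=\Omega\cap R\,\Omega$ is symmetric, so $x$
and $Rx$ receive the same amount from it, whereas every point of the rest $N$ lies
below the hyperplane, hence closer to $Rx$ than to $x$. If $x$ is a maximum, $N$ must
be a null set; as $N$ is relatively open in the regular closed set $\Omega$, $N$ is
then empty. *)
Lemma center_reflection_symmetric (Omega : set 'rV[R]_m) h x v b :
  body Omega -> 0 < h -> illuminating_center Omega h x -> sphere v ->
  b < dotv x v -> reflects_into v b Omega ->
  forall y, Omega y -> Omega (refl v b y).
Proof.
move=> [U [oU bU _ OE]] h0 /(light_center h0) xmax v1 bx hR.
have cO : closed Omega by rewrite OE; exact: closed_closure.
have mO := measurable_closed cO.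
pose S := refl v b; have SK : involutive S by exact: reflK.
have [mS hS] : preserves_lebesgue S by exact: preserves_refl.
have mSO : measurable (S @^-1` Omega) by rewrite -[X in measurable X]setTI; exact: mS.
have [M M0 UM] := bounded_enorm bU.
have OM y : Omega y -> enorm y <= M.
  rewrite OE => /closure_eballP yU; apply/ler_addgt0Pr => e /yU[z /UM zM zy].
  by have := enorm_triangle z y 0; rewrite !subr0 enormBC; lra.
pose Q := Omega `&` S @^-1` Omega; pose N := Omega `\` S @^-1` Omega.
have mQ : measurable Q by exact: measurableI.
have mN : measurable N by exact: measurableD.
have OQN : Omega = Q `|` N by rewrite /Q /N setUIDK.
have QN0 : [disjoint Q & N].
  by rewrite disj_set2E; apply/eqP/seteqP; split => // z [[_ ?] [_]].
have SQ : S @^-1` Q = Q.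
  by apply/seteqP; split=> z []; rewrite /Q /= ?SK => ? ?; split => //=; rewrite SK.
have Qxx : light Q h (S x) = light Q h x by exact: light_symmetric.
have loo A : measurable A -> A `<=` Omega -> (light A h x < +oo)%E.
  move=> mA AO; apply: (light_lty x (r := M) h0 mA) => z /AO /OM.
  by rewrite /eball/= subr0.
have lQ : (light Q h x < +oo)%E by apply: (loo _ mQ) => z [].
have lN : (light N h x < +oo)%E by apply: (loo _ mN) => z [].
have Qfin : light Q h x \is a fin_num.
  by rewrite ge0_fin_numE; last exact: light_ge0.
have hN : (light N h (S x) <= light N h x)%E.
  have := xmax (S x); rewrite OQN (light_setU h (S x) mQ mN QN0).
  by rewrite (light_setU h x mQ mN QN0) Qxx leeD2lE.
rewrite lightE in lN; rewrite !lightE in hN.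
have N0 : lebesgue_rV m N = 0%E.
  apply: (measure0_integral_le mN (measurable_decay h (S x))
    (measurable_decay h x) _ _ lN hN) => z; first exact: decay_ge0.
  move=> [Oz /= nz]; apply: decay_lt => //; apply: enorm_reflB => //.
  by rewrite ltNge; apply/negP => /(hR z Oz).
suff US z : U z -> Omega (S z).
  move=> y Oy; have /closure_eballP yU : closure U y by rewrite -OE.
  apply/cO/closure_eballP => e /yU[z Uz zy].
  by exists (S z); [exact: US|rewrite /S enorm_refl].
move=> Uz; apply: contrapT => nz.
have [r1 r10 U1] := (open_eballP U).1 oU z Uz.
have [r2 r20 U2] := (open_eballP (~` Omega)).1 (closed_openC cO) (S z) nz.
have r0 : 0 < Num.min r1 r2 by rewrite lt_min r10.
have := lebesgue_eball_gt0 z r0; rewrite ltNge => /negP; apply.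
rewrite -N0; apply: le_measure; rewrite ?inE//; first exact: measurable_eball.
move=> w; rewrite /eball/= le_min => /andP[w1 w2]; split.
  by rewrite OE; apply: subset_closure; exact: U1.
by apply: U2; rewrite /eball/= /S enorm_refl.
Qed.

(** Between the folding level and $x$ there would be two hyperplanes of symmetry;
composing the reflections in them translates $\Omega$ into itself. *)
Lemma center_in_unfolded (Omega : set 'rV[R]_m) h x :
  body Omega -> 0 < h -> illuminating_center Omega h x ->
  minimal_unfolded_region Omega x.
Proof.
move=> bO h0 xmax v v1 /=; rewrite leNgt; apply/negP => lx.
have [U [oU bU [p Up] OE]] := bO.
have [M M0 UM] := bounded_enorm bU.
have OM y : Omega y -> dotv y v <= M.
  rewrite OE => /closure_eballP yU; apply/ler_addgt0Pr => e /yU[z /UM zM zy].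
  have := dotv_le_enorm z v1; have := dotv_le_enorm (y - z) v1.
  by rewrite enormBC !dotvE; lra.
have Op : Omega p by rewrite OE; exact: subset_closure.
pose E := [set a | forall b, a <= b ->
  refl v b @` (Omega `&` [set z | b <= dotv z v]) `<=` Omega].
have E0 : E !=set0.
  exists (M + 1) => b Mb _ [y [/OM yM /= by_] <-].
  by exfalso; have := le_trans Mb (le_trans by_ yM); lra.
have [a Ea ax] : exists2 a, E a & a < dotv x v.
  apply: contrapT => nE; move: lx; apply/negP; rewrite -leNgt.
  apply: lb_le_inf => // a Ea; rewrite leNgt; apply/negP => ax.
  by apply: nE; exists a.
have sym b : a <= b -> b < dotv x v -> forall y, Omega y -> Omega (refl v b y).
  move=> ab bx; apply: (center_reflection_symmetric bO h0 xmax v1 bx) => y Oy yb.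
  by apply: (Ea b ab); exists y.
pose b1 := a; pose b2 := (a + dotv x v) / 2.
have b12 : b1 < b2 by rewrite /b1 /b2; lra.
have b2x : b2 < dotv x v by rewrite /b2; lra.
have tr y : Omega y -> Omega (y + (2 * (b2 - b1)) *: v).
  move=> Oy; have := sym b2 (ltW b12) b2x _ (sym b1 (lexx _) ax _ Oy).
  congr Omega; rewrite /refl !dotvE (dotv_sphere v1).
  by apply/rowP => i; rewrite !mxE; ring.
have trn n : Omega (p + (2 * (b2 - b1) * n%:R) *: v).
  elim: n => [|n /tr]; first by rewrite mulr0 scale0r addr0.
  congr Omega; apply/rowP => i; rewrite !mxE -natr1; ring.
have c0 : 0 < 2 * (b2 - b1) by lra.
have := archi_boundP (normr_ge0 ((M - dotv p v) / (2 * (b2 - b1)))).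
set n := Num.bound _ => hn.
have := OM _ (trn n); rewrite !dotvE (dotv_sphere v1) mulr1.
rewrite leNgt => /negP; apply; rewrite -ltrBlDl.
by rewrite [ltRHS]mulrC -ltr_pdivrMr//; apply: le_lt_trans hn; exact: ler_norm.
Qed.

End Reflection.

(** * Bodies and the position of centers relative to half-spaces *)

Section BodyGeometry.
Context {R : realType} {m : nat}.
Implicit Types (x y z p u v : 'rV[R]_m) (A Omega : set 'rV[R]_m).

Lemma distv_ge0 x A : 0 <= distv x A.
Proof.
rewrite /distv; have [->|/set0P[y Ay]] := eqVneq A set0.
  by rewrite image_set0 inf0.
by apply: lb_le_inf => [|_ [z _ <-]]; [exists (enorm (x - y)), y|exact: enorm_ge0].
Qed.

Lemma distv_le x y A : A y -> distv x A <= enorm (x - y).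
Proof.
move=> Ay; apply: ge_inf; last by exists y.
by exists 0 => _ [z _ <-]; exact: enorm_ge0.
Qed.

Lemma le_distv x A a : A !=set0 -> (forall y, A y -> a <= enorm (x - y)) ->
  a <= distv x A.
Proof.
move=> [y Ay] h; apply: lb_le_inf; first by exists (enorm (x - y)), y.
by move=> _ [z Az <-]; exact: h.
Qed.

Lemma distv_lipschitz x y A : A !=set0 -> distv x A <= distv y A + enorm (x - y).
Proof.
move=> A0; rewrite -lerBlDr; apply: le_distv => // z Az.
by rewrite lerBlDr addrC (le_trans (distv_le x Az))// enorm_triangle.
Qed.

Lemma distv_adherent x A e : A !=set0 -> 0 < e ->
  exists2 y, A y & enorm (x - y) < distv x A + e.
Proof.
move=> [y Ay] e0; have : has_inf [set enorm (x - y) | y in A].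
  split; first by exists (enorm (x - y)), y.
  by exists 0 => _ [z _ <-]; exact: enorm_ge0.
by move=> /(inf_adherent e0)[_ [z Az <-] zx]; exists z.
Qed.

Lemma lipschitz_continuous (f : 'rV[R]_m -> R) :
  (forall x y, f x <= f y + enorm (x - y)) -> continuous f.
Proof.
move=> fL x; apply/(@cvgrPdist_le _ _ _ (nbhs x) (nbhs_filter x)) => e e0.
have := nbhs_eball x e0; apply: filterS => y; rewrite /eball/= => yx.
rewrite ler_distl; have := fL x y; have := fL y x.
by rewrite (enormBC x y); lra.
Qed.

(** Minimize $|x-y|$ over the compact part of the closure near $x$. *)
Lemma distv_closure_attained x A : A !=set0 ->
  exists2 y, closure A y & enorm (x - y) = distv x A.
Proof.
move=> A0; pose C := closure A `&` eball (distv x A + 1) x.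
have cC : compact C.
  apply: bounded_closed_compact; last first.
    by apply: closedI; [exact: closed_closure|exact: eball_closed].
  apply: (enorm_bounded (M := distv x A + 1 + enorm x)) => y [_].
  rewrite /eball/= => yx; have := enorm_triangle x y 0; rewrite !subr0; lra.
have [y0 Ay0 xy0] := distv_adherent x A0 ltr01.
have C0 : C !=set0.
  exists y0; split; first exact: subset_closure.
  by rewrite /eball/= enormBC ltW.
have cf : {within C, continuous (fun y => enorm (x - y))}.
  apply: continuous_subspaceT; apply: lipschitz_continuous => y z.
  by rewrite (enormBC y z); exact: enorm_triangle.
have [y /set_mem[Ay _] hy] := EVT_min_rV C0 cC cf.
exists y => //; apply/eqP; rewrite eq_le; apply/andP; split.
  apply/ler_addgt0Pr => e e0.
  have e1 : 0 < Num.min e 1 by rewrite lt_min e0 ltr01.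
  have [z Az xz] := distv_adherent x A0 e1.
  apply: le_trans (hy z _) _.
    apply/mem_set; split; first exact: subset_closure.
    rewrite /eball/= enormBC; apply: le_trans (ltW xz) _.
    by rewrite lerD2l ge_min lexx orbT.
  by apply: le_trans (ltW xz) _; rewrite lerD2l ge_min lexx.
apply/ler_addgt0Pr => e e0.
move: Ay => /closure_eballP/(_ e e0)[z Az zy].
apply: le_trans (distv_le x Az) _; apply: le_trans (enorm_triangle y _ _) _.
by rewrite lerD2l enormBC.
Qed.

Lemma body_closed Omega : body Omega -> closed Omega.
Proof. by move=> [U [_ _ _ ->]]; exact: closed_closure. Qed.

Lemma body_bounded Omega : body Omega ->
  exists2 M, 0 < M & forall y, Omega y -> enorm y <= M.
Proof.
move=> [U [_ bU _ ->]]; have [M M0 UM] := bounded_enorm bU; exists M => // y.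
move=> /closure_eballP yU; apply/ler_addgt0Pr => e /yU[z /UM zM zy].
by have := enorm_triangle z y 0; rewrite !subr0 enormBC; lra.
Qed.

Lemma body_nonempty Omega : body Omega -> Omega !=set0.
Proof. by move=> [U [_ _ [p Up] ->]]; exists p; exact: subset_closure. Qed.

Lemma enorm_le_diam Omega y z :
  body Omega -> Omega y -> Omega z -> enorm (y - z) <= diam Omega.
Proof.
move=> /body_bounded[M M0 OM] Oy Oz; apply: ub_le_sup; last by exists (y, z).
exists (M + M) => _ [[a b] [/= /OM aM /OM bM] <-] /=.
by apply: le_trans (enormD _ _) _; rewrite enormN lerD.
Qed.

Lemma sphere_evec (k : nat) : (k < m)%N -> sphere (evec m k : 'rV[R]_m).
Proof.
move=> km; apply: sphere_dotv; rewrite /dotv (bigD1 (Ordinal km))//= big1.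
  by rewrite !mxE/= eqxx mulr1 addr0.
by move=> i; rewrite -val_eqE/= !mxE => /negbTE->; rewrite mul0r.
Qed.

Lemma body_setC_nonempty Omega : (0 < m)%N -> body Omega -> ~` Omega !=set0.
Proof.
move=> m0 /body_bounded[M M0 OM]; exists ((M + 1) *: evec m 0) => /OM.
by rewrite enormZ (sphere_evec m0) mulr1 ger0_norm; lra.
Qed.

(** The inradius is attained, as the maximum of a continuous function on a compact
set. *)
Lemma incenter Omega : (0 < m)%N -> body Omega ->
  exists p, eball (inradius Omega) p `<=` Omega.
Proof.
move=> m0 bO; have C0 := body_setC_nonempty m0 bO.
have [M M0 OM] := body_bounded bO.
have cO : compact Omega.
  apply: bounded_closed_compact; [exact: enorm_bounded OM|exact: body_closed].
have cf : {within Omega, continuous (fun x => distv x (~` Omega))}.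
  apply: continuous_subspaceT; apply: lipschitz_continuous => y z.
  exact: distv_lipschitz.
have [p /set_mem Op hp] := EVT_max_rV (body_nonempty bO) cO cf.
have -> : inradius Omega = distv p (~` Omega).
  apply/eqP; rewrite eq_le; apply/andP; split.
    apply: ge_sup; first by exists (distv p (~` Omega)), p.
    by move=> _ [z /mem_set/hp ? <-].
  apply: ub_le_sup; last by exists p.
  by exists (distv p (~` Omega)) => _ [z /mem_set/hp ? <-].
set r := distv p _; exists p => y; rewrite /eball/= => yp.
have inside z : enorm (z - p) < r -> Omega z.
  move=> zp; apply: contrapT => nz; have := distv_le (A := ~` Omega) p nz.
  by rewrite enormBC leNgt zp.
have [yr|yr] := ltP (enorm (y - p)) r; first exact: inside.
have {yp}yr : enorm (y - p) = r by apply/eqP; rewrite eq_le yp yr.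
have [r0|] := ltP 0 r; last first.
  rewrite le_eqVlt ltNge distv_ge0 orbF => /eqP r0.
  by move: yr; rewrite r0 => /enorm_eq0/eqP; rewrite subr_eq0 => /eqP->.
apply: (body_closed bO); apply/closure_eballP => e e0.
pose t := Num.min (1 / 2) (e / r).
have t0 : 0 < t by rewrite lt_min divr_gt0// divr_gt0.
have t1 : t <= 1 / 2 by rewrite ge_min lexx.
have te : t * r <= e by rewrite -ler_pdivlMr// ge_min lexx orbT.
exists (y - t *: (y - p)).
  apply: inside.
  have -> : y - t *: (y - p) - p = (1 - t) *: (y - p).
    by apply/rowP => i; rewrite !mxE; ring.
  by rewrite enormZ yr ger0_norm; nra.
have -> : y - t *: (y - p) - y = - (t *: (y - p)).
  by apply/rowP => i; rewrite !mxE; ring.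
by rewrite enormN enormZ yr ger0_norm// ltW.
Qed.

Lemma inradius_gt0 Omega : (0 < m)%N -> body Omega -> 0 < inradius Omega.
Proof.
move=> m0 bO; have C0 := body_setC_nonempty m0 bO.
have [M M0 OM] := body_bounded bO; have [c nc] := C0.
have [U [oU bU [z Uz] OE]] := bO.
have [r r0 rU] := (open_eballP U).1 oU z Uz.
have UO : U `<=` Omega by rewrite OE; exact: subset_closure.
apply: (lt_le_trans r0); apply: (@le_trans _ _ (distv z (~` Omega))).
  apply: le_distv => // y ny; rewrite leNgt; apply/negP => zy; apply: ny.
  by apply/UO/rU; rewrite /eball/= enormBC ltW.
apply: ub_le_sup; last by exists z => //; exact: UO.
exists (M + enorm c) => _ [y /OM yM <-]; apply: le_trans (distv_le y nc) _.
by apply: le_trans (enormD _ _) _; rewrite enormN lerD2r.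
Qed.

(** The inscribed ball has diameter $2R_\infty$. *)
Lemma inradius_lt_diam Omega : (0 < m)%N -> body Omega ->
  inradius Omega < diam Omega.
Proof.
move=> m0 bO; have r0 := inradius_gt0 m0 bO; have [p pO] := incenter m0 bO.
set r := inradius Omega in r0 pO *; pose e : 'rV[R]_m := evec m 0.
have Oe s : `|s| <= r -> Omega (p + s *: e).
  move=> sr; apply: pO; rewrite /eball/= addrAC subrr add0r enormZ.
  by rewrite (sphere_evec m0) mulr1.
have := enorm_le_diam bO (Oe r _) (Oe (- r) _).
rewrite normrN (ger0_norm (ltW r0)) lexx => /(_ isT isT).
rewrite (_ : _ - _ = (r + r) *: e); last by apply/rowP => i; rewrite !mxE; ring.
by rewrite enormZ (sphere_evec m0) mulr1 ger0_norm; lra.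
Qed.

(** Otherwise $\Omega$ would be symmetric in a hyperplane that separates it from the
center, so that part of $\Omega$ would lie beyond this hyperplane. *)
Lemma center_half_space Omega h x v a : body Omega -> 0 < h ->
  illuminating_center Omega h x -> sphere v ->
  (forall z, Omega z -> dotv z v <= a) -> dotv x v <= a.
Proof.
move=> bO h0 xmax v1 Oa; rewrite leNgt; apply/negP => ax.
pose b := (a + dotv x v) / 2; have ab : a < b by rewrite /b; lra.
have bx : b < dotv x v by rewrite /b; lra.
have [z Oz] := body_nonempty bO.
have hR : reflects_into v b Omega.
  by move=> y /Oa ya; rewrite leNgt (le_lt_trans ya ab).
have := Oa _ (center_reflection_symmetric bO h0 xmax v1 bx hR Oz).
by rewrite /refl !dotvE (dotv_sphere v1); have := Oa z Oz; lra.
Qed.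

(** Apply the preceding lemma in the direction from $z$ to the center: the half-space at
distance $\mathrm{diam}\,\Omega$ beyond $z$ contains $\Omega$. *)
Lemma body_sub_eball_center Omega h x : body Omega -> 0 < h ->
  illuminating_center Omega h x -> Omega `<=` eball (diam Omega) x.
Proof.
move=> bO h0 xmax z Oz; rewrite /eball/= enormBC.
have [->|xz] := eqVneq x z.
  by rewrite subrr enorm0 -(enorm0 (R := R) (m := m)) -(subrr z) enorm_le_diam.
have n0 : x - z != 0 by rewrite subr_eq0.
have v1 := sphere_normalize n0; set v := _ *: _ in v1.
have vxz : dotv (x - z) v = enorm (x - z).
  by rewrite /v dotvZr -enorm_sqr expr2 mulrA mulVf ?mul1r// gt_eqF// enorm_gt0.
have := center_half_space (a := dotv z v + diam Omega) bO h0 xmax v1.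
have -> : dotv x v = dotv (x - z) v + dotv z v by rewrite -dotvDl subrK.
rewrite vxz => H; suff /H : forall y, Omega y -> dotv y v <= dotv z v + diam Omega.
  by lra.
move=> y Oy.
have -> : dotv y v = dotv z v + dotv (y - z) v by rewrite -dotvDl addrC subrK.
by rewrite lerD2l (le_trans (dotv_le_enorm _ v1))// enorm_le_diam.
Qed.

End BodyGeometry.

(** * Cones and congruences *)

Section Cones.
Context {R : realType} {m : nat}.
Implicit Types (x y z u v w : 'rV[R]_m) (V : set 'rV[R]_m).
Implicit Types (kappa r e : R) (delta : \bar R).

Lemma open_coneP x v kappa delta z : open_cone x v kappa delta z <->
  [/\ 0 < enorm (z - x), ((enorm (z - x))%:E < delta)%E &
      cos (kappa / 2) * enorm (z - x) < dotv (z - x) v].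
Proof.
split=> [[r [w [[r0 rd] w1 wv ->]]]|[n0 nd nv]].
  rewrite addrAC subrr add0r enormZ w1 mulr1 gtr0_norm//; split => //.
  by rewrite dotvZl [ltLHS]mulrC ltr_pM2l.
have zx0 : z - x != 0.
  by apply/eqP => zx; move: n0; rewrite zx enorm0 ltxx.
exists (enorm (z - x)), ((enorm (z - x))^-1 *: (z - x)); split => //.
- exact: sphere_normalize.
- by rewrite dotvZl [ltRHS]mulrC ltr_pdivlMr.
- by rewrite scalerA divff ?gt_eqF// scale1r addrC subrK.
Qed.

Lemma lte_fin_slack r delta : (r%:E < delta)%E ->
  exists2 e, 0 < e & ((r + e)%:E < delta)%E.
Proof.
case: delta => [d| |]//; last by move=> _; exists 1; rewrite ?ltry.
rewrite lte_fin => rd; exists ((d - r) / 2); first by rewrite divr_gt0// subr_gt0.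
by rewrite lte_fin; lra.
Qed.

(** Membership in an open cone is stable under small perturbations of the point, of the
vertex and of the axis; both the openness of cones and the cone condition at boundary
points follow. *)
Lemma open_cone_perturb y v kappa delta q : open_cone y v kappa delta q ->
  exists2 e, 0 < e & forall y' v' q', sphere v' -> enorm (y' - y) <= e ->
    enorm (q' - q) <= e -> enorm (v' - v) <= e -> open_cone y' v' kappa delta q'.
Proof.
move=> /open_coneP[r0 rd cv]; set c := cos (kappa / 2) in cv *.
have [c1 c2] : -1 <= c /\ c <= 1 by rewrite cos_geN1 cos_le1.
have [e1 e10 re1] := lte_fin_slack rd.
set r := enorm (q - y) in r0 rd cv re1 *.
pose s := dotv (q - y) v - c * r; have s0 : 0 < s by rewrite subr_gt0.
pose e := Num.min (e1 / 4) (Num.min (r / 4) (s / (2 * r + 8))).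
have d0 : 0 < 2 * r + 8 by lra.
have e0 : 0 < e by rewrite !lt_min !divr_gt0.
have ee1 : e <= e1 / 4 by rewrite /e ge_min lexx.
have er : e <= r / 4 by rewrite /e !ge_min lexx orbT.
have es : e * (2 * r + 8) <= s.
  by rewrite -ler_pdivlMr// /e !ge_min lexx !orbT.
exists e => // y' v' q' v'1 hy hq hv; apply/open_coneP.
have dq : q' - y' = (q - y) + ((q' - q) - (y' - y)).
  by apply/rowP => i; rewrite !mxE; ring.
have dn : enorm ((q' - q) - (y' - y)) <= 2 * e.
  by apply: le_trans (enormD _ _) _; rewrite enormN; lra.
have rN : enorm (q' - y') <= r + 2 * e.
  by rewrite dq; apply: le_trans (enormD _ _) _; rewrite lerD2l.
have rn : r <= enorm (q' - y') + 2 * e.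
  rewrite /r (_ : q - y = (q' - y') - ((q' - q) - (y' - y))); last first.
    by apply/rowP => i; rewrite !mxE; ring.
  by apply: le_trans (enormD _ _) _; rewrite enormN lerD2l.
split.
- lra.
- by apply: le_lt_trans re1; rewrite lee_fin; lra.
have h1 : - (r * e) <= dotv (q - y) (v' - v).
  rewrite -[leRHS]opprK lerN2 -dotvNr; apply: le_trans (cauchy_schwarz _ _) _.
  by rewrite enormN ler_pM2l.
have h2 : - (2 * e) <= dotv ((q' - q) - (y' - y)) v'.
  rewrite -[leRHS]opprK lerN2 -dotvNl; apply: le_trans (dotv_le_enorm _ v'1) _.
  by rewrite enormN.
have h3 : c * enorm (q' - y') <= c * r + 2 * e by nra.
have -> : dotv (q' - y') v' =
    dotv (q - y) v + dotv (q - y) (v' - v) + dotv ((q' - q) - (y' - y)) v'.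
  by rewrite -dotvDr [v + _]addrC subrK -dotvDl -dq.
have sE : s = dotv (q - y) v - c * r by [].
have re0 : 0 <= r * e by rewrite mulr_ge0// ltW.
rewrite -/c; lra.
Qed.

Lemma open_cone_open y v kappa delta : sphere v ->
  open (open_cone y v kappa delta).
Proof.
move=> v1; apply/open_eballP => q /open_cone_perturb[e e0 h]; exists e => // q' hq.
by apply: h => //; rewrite subrr enorm0 ltW.
Qed.

Lemma compact_sphere : compact (@sphere R m).
Proof.
apply: bounded_closed_compact.
  by apply: (enorm_bounded (M := 1)) => v ->.
move=> v /closure_eballP h; apply/eqP; rewrite eq_le; apply/andP; split.
  apply/ler_addgt0Pr => e /h[w w1 wv].
  by have := enorm_triangle w v 0; rewrite !subr0 w1 enormBC; lra.
apply/ler_addgt0Pr => e /h[w w1 wv].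
by have := enorm_triangle v w 0; rewrite !subr0 w1; lra.
Qed.

(** Cones with vertices tending to a boundary point have a subsequence of converging
axes, since the sphere is compact. *)
Lemma interior_cone_closure V kappa delta y :
  uniform_interior_cone V kappa delta -> closure V y ->
  exists2 v, sphere v & open_cone y v kappa delta `<=` V.
Proof.
move=> [_ hV] /closure_eballP Vy.
have /choice[f hf] (n : nat) : exists p : 'rV[R]_m * 'rV[R]_m,
    [/\ enorm (p.1 - y) <= n.+1%:R^-1, sphere p.2 &
        open_cone p.1 p.2 kappa delta `<=` V].
  have n0 : 0 < n.+1%:R^-1 :> R by rewrite invr_gt0.
  have [z /hV[v v1 vV] zy] := Vy _ n0.
  by exists (z, v).
pose F : set_system 'rV[R]_m := (fun n => (f n).2) @ \oo.
have FS : F sphere by exists 0%N => // n _; have [] := hf n.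
have FP : ProperFilter F := fmap_proper_filter _ eventually_filter.
have [v [v1 Fv]] := compact_sphere FP FS.
exists v => // q /open_cone_perturb[e e0 he].
pose N := Num.bound e^-1.
have FN : F [set (f n).2 | n in [set n | (N <= n)%N]].
  by exists N => // n /= Nn; exists n.
have [_ [[n /= Nn <-] fv]] := Fv _ _ FN (nbhs_eball v e0).
have [fy f1 fV] := hf n; apply: fV; apply: he => //.
- apply: le_trans fy _; rewrite invf_ple ?posrE//.
  have /archi_boundP/ltW/le_trans : 0 <= e^-1 by rewrite invr_ge0 ltW.
  by apply; rewrite ler_nat (leq_trans Nn).
- by rewrite subrr enorm0 ltW.
Qed.

End Cones.

Section Isometries.
Context {R : realType} {m : nat}.
Implicit Types (x y z u v w e : 'rV[R]_m) (T : 'rV[R]_m -> 'rV[R]_m).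

Definition linear_isometry T := [/\ preserves_lebesgue T,
  forall x y, T (x - y) = T x - T y, forall a x, T (a *: x) = a *: T x &
  forall x y, dotv (T x) (T y) = dotv x y].

Lemma linear_isometry_enorm T x : linear_isometry T -> enorm (T x) = enorm x.
Proof. by move=> [_ _ _ h]; rewrite /enorm h. Qed.

Lemma linear_isometryD T x y : linear_isometry T -> T (x + y) = T x + T y.
Proof.
move=> [_ hB hZ _]; have -> : x + y = x - (-1) *: y by rewrite scaleN1r opprK.
by rewrite hB hZ scaleN1r opprK.
Qed.

Lemma linear_isometry_comp T T' :
  linear_isometry T -> linear_isometry T' -> linear_isometry (T \o T').
Proof.
move=> [pT BT ZT dT] [pT' BT' ZT' dT']; split.
- exact: preserves_comp.
- by move=> x y /=; rewrite BT' BT.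
- by move=> a x /=; rewrite ZT' ZT.
- by move=> x y /=; rewrite dT dT'.
Qed.

Lemma linear_isometry_id : linear_isometry id.
Proof. by split => //; split => //; exact: measurable_id. Qed.

Lemma linear_isometry_refl v : sphere v -> linear_isometry (refl v 0).
Proof.
move=> v1; split.
- exact: preserves_refl.
- by move=> x y; rewrite /refl !dotvE; apply/rowP => i; rewrite !mxE; ring.
- by move=> a x; rewrite /refl !dotvE; apply/rowP => i; rewrite !mxE; ring.
- move=> x y; rewrite /refl !dotvE (dotv_sphere v1) (dotvC v y); ring.
Qed.

Lemma dotv_sphere_itv e v : sphere e -> sphere v -> -1 <= dotv e v <= 1.
Proof.
move=> e1 v1; rewrite lerNl -dotvNl.
have := dotv_le_enorm e v1; have := dotv_le_enorm (- e) v1.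
by rewrite enormN e1 => -> ->.
Qed.

(** The Householder reflection exchanging $a$ and $b$. *)
Lemma householder a b : sphere a -> sphere b -> exists T, [/\ linear_isometry T,
  T a = b & forall z : 'rV[R]_m, dotv z a = dotv z b -> T z = z].
Proof.
move=> a1 b1; have [->|ab] := eqVneq a b.
  by exists id; split => //; exact: linear_isometry_id.
have n0 : a - b != 0 by rewrite subr_eq0.
have v1 := sphere_normalize n0; set v := _ *: _ in v1.
exists (refl v 0); split; first exact: linear_isometry_refl.
  have l0 := enorm_gt0 n0.
  have l2 := enorm_sqr (a - b); move: l2.
  rewrite !dotvE (dotv_sphere a1) (dotv_sphere b1) (dotvC b a) => l2.
  rewrite /refl /v !dotvE (dotv_sphere a1) scalerA.
  set c := 2 * _ * _; suff -> : c = 1 by rewrite scale1r opprB addrC subrK.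
  rewrite /c; set l := enorm (a - b) in l0 l2 *.
  have -> : 2 * (l^-1 * (1 - dotv a b) - 0) * l^-1 =
    (2 * (1 - dotv a b)) / l ^+ 2 by field; rewrite gt_eqF.
  rewrite l2; field; apply/negP => /eqP h.
  move: (exprn_gt0 2 l0); rewrite l2; lra.
move=> z hz; rewrite /refl /v !dotvE hz.
by rewrite subrr mulr0 subr0 mulr0 scale0r subr0.
Qed.

(** A reflection takes $e_0$ to $e$; a second one, whose axis is orthogonal to $e$,
adjusts the image of $e_1$. *)
Lemma isometry_frame e0 e1 e u : sphere e0 -> sphere e1 -> dotv e0 e1 = 0 ->
  sphere e -> sphere u -> dotv e u = 0 ->
  exists T, [/\ linear_isometry T, T e0 = e & T e1 = u].
Proof.
move=> s0 s1 d01 se su deu; have [T1 [iT1 T1e _]] := householder s0 se.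
have sw : sphere (T1 e1) by rewrite /sphere/= linear_isometry_enorm.
have [T2 [iT2 T2u T2z]] := householder sw su.
exists (T2 \o T1); split => //=; first exact: linear_isometry_comp.
rewrite T1e T2z// deu -T1e.
by case: iT1 => _ _ _ ->.
Qed.

Hypothesis hm : (2 <= m)%N.

Let m_gt0 : (0 < m)%N. Proof. exact: ltn_trans hm. Qed.

Lemma sphere_evec0 : sphere (evec m 0 : 'rV[R]_m).
Proof. exact: sphere_evec. Qed.

Lemma sphere_evec_last : sphere (evec m m.-1 : 'rV[R]_m).
Proof. by apply: sphere_evec; rewrite prednK. Qed.

Lemma dotv_evec : dotv (evec m 0 : 'rV[R]_m) (evec m m.-1) = 0.
Proof.
rewrite /dotv big1// => i _; rewrite !mxE.
case: (_ =P 0%N) => [->|]; last by rewrite mul0r.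
by case: m hm => [|[|n]]//= _; rewrite mulr0.
Qed.

Lemma plane_basis e v : sphere e -> sphere v -> exists u,
  [/\ sphere u, dotv e u = 0 &
      v = cos (acos (dotv e v)) *: e + sin (acos (dotv e v)) *: u].
Proof.
move=> se sv; set c := dotv e v.
have c1 : -1 <= c <= 1 := dotv_sphere_itv se sv.
have ec : cos (acos c) = c by rewrite acosK// in_itv.
have es := sin_acos c1; rewrite ec es.
pose q := v - c *: e.
have qq : dotv q q = 1 - c ^+ 2.
  by rewrite /q !dotvE (dotv_sphere sv) (dotv_sphere se) (dotvC v e) -/c; ring.
have eq0 : dotv e q = 0 by rewrite /q !dotvE (dotv_sphere se) -/c; ring.
have vq : v = c *: e + q by rewrite /q addrC subrK.
have [q0|q0] := eqVneq q 0.
  have [T1 [iT1 T1e _]] := householder sphere_evec0 se.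
  exists (T1 (evec m m.-1)); split.
  - by rewrite /sphere/= linear_isometry_enorm//; exact: sphere_evec_last.
  - by rewrite -T1e; case: iT1 => _ _ _ ->; exact: dotv_evec.
  - by rewrite -qq q0 dotv0l sqrtr0 scale0r addr0 {1}vq q0 addr0.
exists ((enorm q)^-1 *: q); split; first exact: sphere_normalize.
  by rewrite dotvZr eq0 mulr0.
by rewrite -qq -/(enorm q) scalerA divff ?scale1r// gt_eqF// enorm_gt0.
Qed.

(** Every pair of unit vectors is congruent to a pair in the plane of $e_1$ and $e_m$ in
which the directions $C_\theta$ are taken. *)
Lemma isometry_plane e v : sphere e -> sphere v -> exists T,
  [/\ linear_isometry T, T (evec m 0) = e &
      T (cos (acos (dotv e v)) *: evec m 0 +
         sin (acos (dotv e v)) *: evec m m.-1) = v].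
Proof.
move=> se sv; have [u [su eu vE]] := plane_basis se sv.
have [T [iT T0 T1]] :=
  isometry_frame sphere_evec0 sphere_evec_last dotv_evec se su eu.
exists T; split => //; rewrite linear_isometryD//; case: (iT) => _ _ hZ _.
by rewrite !hZ T0 T1 -vE.
Qed.

(** If $\theta>(\pi-\kappa)/2$, tilting the axis slightly gives a direction of the cone
that makes an obtuse angle with $e$. *)
Lemma cone_angle_le e v kappa : 0 < kappa <= pi -> sphere e -> sphere v ->
  (forall w, sphere w -> cos (kappa / 2) < dotv w v -> 0 <= dotv w e) ->
  acos (dotv e v) <= (pi - kappa) / 2.
Proof.
move=> /andP[k0 kpi] se sv h; rewrite leNgt; apply/negP => ht.
have [u [su eu vE]] := plane_basis se sv.
have c1 := dotv_sphere_itv se sv.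
have t0 := acos_ge0 c1; have tpi := acos_lepi c1.
set t := acos _ in vE ht t0 tpi.
pose psi := if pi / 2 < t then t else (pi / 2 + t + kappa / 2) / 2.
have pi0 : 0 < pi :> R := pi_gt0 R.
have [p1 p2 p3 p4] : [/\ pi / 2 < psi, psi <= pi, 0 <= psi - t &
    psi - t < kappa / 2].
  by rewrite /psi; case: ifPn => [?|]; rewrite -?leNgt => *; split; lra.
have csp := cos2Dsin2 psi.
pose w := cos psi *: e + sin psi *: u.
have sw : sphere w.
  apply: sphere_dotv; rewrite /w !dotvE (dotv_sphere se) (dotv_sphere su).
  by rewrite (dotvC u e) eu -[RHS]csp; ring.
have wv : dotv w v = cos (psi - t).
  rewrite vE /w !dotvE (dotv_sphere se) (dotv_sphere su) (dotvC u e) eu cosB; ring.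
have : 0 <= dotv w e.
  by apply: h => //; rewrite wv ltr_cos// in_itv/=; apply/andP; split; lra.
rewrite /w !dotvE (dotv_sphere se) (dotvC u e) eu mulr0 addr0 mulr1 leNgt.
move=> /negP; apply; rewrite -(@cos_pihalf R) ltr_cos// in_itv/=;
  by apply/andP; split; lra.
Qed.

Lemma cone_isometry T x v y u kappa delta : linear_isometry T ->
  T x = y -> T v = u ->
  T @^-1` open_cone y u kappa delta = open_cone x v kappa delta.
Proof.
move=> iT <- <-; have hn z := linear_isometry_enorm z iT.
have [_ hB _ hd] := iT.
by apply/seteqP; split => z /= /open_coneP hz; apply/open_coneP;
  move: hz; rewrite -hB hn hd.
Qed.

End Isometries.

(** * Light lost in cones and in the shell *)

Section Powers.
Context {R : realType} {m : nat}.
Implicit Types (x u : 'rV[R]_m) (a h : R).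

Lemma sqr_powR_half a : 0 <= a ->
  (a ^+ 2) `^ (- (m.+1%:R / 2)) = a `^ (- 1 - m%:R).
Proof.
move=> a0; rewrite -powR_mulrn// -powRrM; congr (_ `^ _).
by rewrite -[m.+1%:R]natr1; field.
Qed.

Lemma powR_halfV a : 0 < a -> a `^ (- 1 - m%:R) = (a ^+ m.+1)^-1.
Proof.
by move=> a0; rewrite -opprD addrC natr1 powRN powR_mulrn// ltW.
Qed.

Lemma powRN_le (a b e : R) : 0 < e -> 0 < a -> a <= b -> b `^ (- e) <= a `^ (- e).
Proof.
move=> e0 a0; rewrite le_eqVlt => /orP[/eqP->//|ab].
exact/ltW/powRN_lt.
Qed.

Lemma decay_ge_sqr h u a : 0 < h -> enorm u ^+ 2 + h ^+ 2 <= a ->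
  a `^ (- (m.+1%:R / 2)) <= decay h u.
Proof.
move=> h0; apply: powRN_le; first by rewrite divr_gt0.
by rewrite ltr_wpDl ?sqr_ge0// exprn_gt0.
Qed.

Lemma decay_le_power h u : 0 < enorm u ->
  decay h u <= enorm u `^ (- 1 - m%:R).
Proof.
move=> u0; rewrite -sqr_powR_half ?enorm_ge0//.
apply: powRN_le; rewrite ?exprn_gt0 ?divr_gt0//.
by rewrite lerDl sqr_ge0.
Qed.

Lemma measurable_enorm_powR (p : R) :
  measurable_fun setT (fun xi : 'rV[R]_m => enorm xi `^ p).
Proof. exact: (measurableT_comp (measurable_powR _) measurable_enorm). Qed.

End Powers.

Section Estimates.
Context {R : realType} {m : nat}.
Implicit Types (A Omega : set 'rV[R]_m) (x y z e v : 'rV[R]_m).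
Implicit Types (a b c h r D kappa : R) (delta : \bar R).
Local Open Scope ereal_scope.

Lemma light_ge_cst A h x c : measurable A -> (0 <= c)%R ->
  (forall z, A z -> (c <= decay h (x - z))%R) ->
  c%:E * lebesgue_rV m A <= light A h x.
Proof.
move=> mA c0 hc; rewrite lightE.
rewrite [leLHS](_ : _ = \int[lebesgue_rV m]_(z in A) (cst c%:E) z); last first.
  by rewrite integral_cst.
apply: (ge0_le_integral _ mA).
- by move=> z _; rewrite lee_fin.
- exact: measurable_cst.
- by apply/measurable_EFinP/measurable_funTS; exact: measurable_decay.
- by move=> z Az; rewrite lee_fin hc.
Qed.

Lemma light_eball r h x :
  light (eball r x) h x = light (eball r 0%R) h (0%R : 'rV[R]_m).
Proof.
have := ge0_integral_preserving (f := fun z => (decay h (x - z))%:E)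
  (preserves_shift x) (measurable_eball r x).
rewrite (_ : _ @^-1` _ = eball r 0%R); last first.
  by apply/seteqP; split => z; rewrite /eball/= addrK subr0.
move=> E; rewrite !lightE -E.
- by apply: eq_integral => z _; rewrite opprD addrCA subrr addr0 add0r.
- by apply/measurable_EFinP; exact: measurable_decay.
- by move=> z; rewrite lee_fin decay_ge0.
Qed.

(** For $D=\mathrm{diam}\,\Omega$ and $r=R_\infty(\Omega)$ its weight
$\int|\xi|^{-1-m}d\xi$ is the constant subtracted in $E$. *)
Definition shell (D r : R) : set 'rV[R]_m := eball D 0%R `\` eball r 0%R.

Lemma measurable_shell D r : measurable (shell D r).
Proof. by apply: measurableD; exact: measurable_eball. Qed.

Lemma shell_weight_lty D r : (0 < r)%R ->
  power_integral (- 1) (shell D r) < +oo.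
Proof.
move=> r0; apply: (@le_lt_trans _ _
    (\int[lebesgue_rV m]_(z in shell D r) (cst (r `^ (- 1 - m%:R))%:E) z)).
  apply: (ge0_le_integral _ (measurable_shell D r)).
  - by move=> z _; rewrite lee_fin powR_ge0.
  - by apply/measurable_EFinP/measurable_funTS; exact: measurable_enorm_powR.
  - exact: measurable_cst.
  - move=> z [_ /negP]; rewrite /eball/= subr0 -ltNge => rz.
    rewrite lee_fin -opprD; apply: powRN_le; [by rewrite ltr_wpDr|exact: r0|exact: ltW].
rewrite integral_cst; last exact: measurable_shell.
rewrite lte_mul_pinfty ?lee_fin ?powR_ge0//.
apply: le_lt_trans (lebesgue_eball_lty D (0 : 'rV[R]_m)%R).
apply: le_measure; rewrite ?inE.
- exact: measurable_shell.
- exact: measurable_eball.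
- by move=> z [].
Qed.

Lemma shell_weight_gt0 D r : (0 < m)%N -> (0 < r < D)%R ->
  0 < power_integral (- 1) (shell D r).
Proof.
move=> m0 /andP[r0 rD]; have D0 := lt_trans r0 rD.
pose z0 : 'rV[R]_m := (((D + r) / 2) *: evec m 0)%R.
pose s := ((D - r) / 4)%R; have s0 : (0 < s)%R by rewrite /s; lra.
have z0n : enorm z0 = ((D + r) / 2)%R.
  by rewrite enormZ (sphere_evec m0) mulr1 ger0_norm; lra.
have zs z : eball s z0 z -> (r < enorm z <= D)%R.
  rewrite /eball/= /s => zz0; have := enorm_triangle z0 z 0%R.
  have := enorm_triangle z z0 0%R; rewrite !subr0 (enormBC z0) z0n => h1 h2.
  by apply/andP; split; lra.
have zsh : eball s z0 `<=` shell D r.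
  move=> z /zs/andP[rz zD]; split; rewrite /eball/= subr0//.
  by apply/negP; rewrite -ltNge.
apply: (@lt_le_trans _ _ ((D `^ (- 1 - m%:R))%:E * lebesgue_rV m (eball s z0))).
  by rewrite mule_gt0 ?lebesgue_eball_gt0// lte_fin powR_gt0.
have mf : measurable_fun (shell D r)
    (fun z : 'rV[R]_m => (enorm z `^ (- 1 - m%:R))%:E).
  by apply/measurable_EFinP/measurable_funTS; exact: measurable_enorm_powR.
apply: (@le_trans _ _ (power_integral (- 1) (eball s z0))); last first.
  apply: (ge0_subset_integral _ (measurable_eball s z0) (measurable_shell D r)) => //.
  by move=> z _; rewrite lee_fin powR_ge0.
rewrite [leLHS](_ : _ = \int[lebesgue_rV m]_(z in eball s z0)
    (cst (D `^ (- 1 - m%:R))%:E) z); last first.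
  by rewrite integral_cst//; exact: measurable_eball.
apply: (ge0_le_integral _ (measurable_eball s z0)).
- by move=> z _; rewrite lee_fin powR_ge0.
- exact: measurable_cst.
- by apply/measurable_EFinP/measurable_funTS; exact: measurable_enorm_powR.
- move=> z /zs/andP[rz zD]; rewrite lee_fin -opprD; apply: powRN_le.
    by rewrite ltr_wpDr.
    exact: lt_trans rz.
  exact: zD.
Qed.

(** Both a center $x$ and an incenter $p$ see a full ball of radius
$D=\mathrm{diam}\,\Omega$ if light from outside $\Omega$ is added; $x$ must not lose more
of it than $p$, and $p$ loses at most what the shell around its inscribed ball
provides. *)
Lemma center_shadow Omega h x : (0 < m)%N -> body Omega -> (0 < h)%R ->
  illuminating_center Omega h x ->
  light (eball (diam Omega) x `\` Omega) h x <=
  power_integral (- 1) (shell (diam Omega) (inradius Omega)).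
Proof.
move=> m0 bO h0 xmax; have OD := body_sub_eball_center bO h0 xmax.
have xm := light_center h0 xmax.
have r0 := inradius_gt0 m0 bO; have rD := inradius_lt_diam m0 bO.
have [p pO] := incenter m0 bO; have mO := measurable_closed (body_closed bO).
set D := diam Omega in OD rD *; set r := inradius Omega in r0 rD pO *.
have mB : measurable (eball D x) by exact: measurable_eball.
have mr : measurable (eball r (0%R : 'rV[R]_m)) by exact: measurable_eball.
have mS : measurable (shell D r) by exact: measurable_shell.
have mBO : measurable (eball D x `\` Omega) by exact: measurableD.
pose o : 'rV[R]_m := 0%R.
have E1 : light (eball D x) h x =
    light Omega h x + light (eball D x `\` Omega) h x.
  rewrite -light_setU//; first by rewrite setDUK.
  by rewrite disj_set2E setDIK.
have E2 : light (eball D o) h o =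
    light (eball r o) h o + light (shell D r) h o.
  rewrite -light_setU//; last by rewrite disj_set2E setDIK.
  rewrite setDUK// => z; rewrite /eball/= => /le_trans; apply; exact: ltW.
have pr : light (eball r o) h o <= light Omega h x.
  rewrite -(light_eball r h p); apply: le_trans (xm p).
  by apply: le_light => //; exact: measurable_eball.
apply: (@le_trans _ _ (light (shell D r) h o)).
  have rfin : light (eball r o) h o \is a fin_num.
    rewrite ge0_fin_numE; last exact: light_ge0.
    exact: (light_lty o h0 mr (@subset_refl _ _)).
  rewrite -(leeD2lE _ _ rfin) -E2 -(light_eball D h x) E1.
  exact: leeD2r.
rewrite lightE; apply: (ge0_le_integral _ mS).
- by move=> z _; rewrite lee_fin decay_ge0.
- by apply/measurable_EFinP/measurable_funTS; exact: measurable_decay.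
- by apply/measurable_EFinP/measurable_funTS; exact: measurable_enorm_powR.
- move=> z [_ /negP]; rewrite /eball/= subr0 -ltNge => rz.
  have zn : enorm (0 - z)%R = enorm z by rewrite add0r enormN.
  by rewrite lee_fin -zn decay_le_power// zn (lt_trans r0).
Qed.

(** A cone with vertex at the light source receives at least $C/h$, since at distance
$h$ from the vertex it contains a ball of radius proportional to $h$. *)
Lemma light_cone_vertex kappa delta D : (0 < kappa <= pi)%R -> 0 < delta ->
  (0 < D)%R -> exists2 C, (0 < C)%R & forall h x v, (0 < h <= 1)%R -> sphere v ->
    (C / h)%:E <= light (open_cone x v kappa delta `&` eball D x) h x.
Proof.
move=> /andP[k0 kpi] d0 D0.
have [e1 e10 e1d] := lte_fin_slack d0; rewrite add0r in e1d.
pose eta := (Num.min e1 D / 4)%R; set c := cos (kappa / 2).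
have eta0 : (0 < eta)%R by rewrite divr_gt0// lt_min e10.
have eta1 : (4 * eta <= e1)%R by rewrite /eta mulrC divfK// ge_min lexx.
have etaD : (4 * eta <= D)%R by rewrite /eta mulrC divfK// ge_min lexx orbT.
have c1 : (c < 1)%R.
  rewrite -(@cos0 R) /c ltr_cos ?in_itv/= ?lexx ?pi_ge0//; first lra.
  by apply/andP; split; lra.
have c2 : (-1 <= c)%R by rewrite cos_geN1.
(* A ball of radius $\sigma\eta$ around the point at distance $\eta$ on the axis lies in
   the cone as soon as $(1-\sigma)/(1+\sigma)>\cos(\kappa/2)$. *)
pose sg := ((1 - c) / 4)%R.
have sg0 : (0 < sg)%R by rewrite /sg; lra.
have sg1 : (sg <= 1 / 2)%R by rewrite /sg; lra.
have sgc : (c * (1 + sg) < 1 - sg)%R by rewrite /sg; nra.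
pose K1 := (4 * eta ^+ 2 + 1)%R.
have K10 : (0 < K1)%R by rewrite ltr_wpDl// mulr_ge0// sqr_ge0.
pose C := (K1 `^ (- (m.+1%:R / 2)) * (sg * eta / m.+1%:R *+ 2) ^+ m)%R.
have C0 : (0 < C)%R.
  by rewrite mulr_gt0 ?powR_gt0// exprn_gt0// mulrn_wgt0// divr_gt0// mulr_gt0.
exists C => // h x v /andP[h0 h1] v1.
pose B := eball (h * (sg * eta))%R (x + (h * eta) *: v)%R.
have he : (0 < h * eta)%R by rewrite mulr_gt0.
have he1 : (h * eta <= eta)%R by rewrite ler_piMl// ltW.
have Bh z : B z -> [/\ (h * eta * (1 - sg) <= enorm (z - x))%R,
    (enorm (z - x) <= h * eta * (1 + sg))%R &
    (h * eta * (1 - sg) <= dotv (z - x)%R v)%R].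
  rewrite /B /eball/= => zB.
  pose w := (z - (x + (h * eta) *: v))%R; have wE : enorm w = enorm w by [].
  have zx : (z - x = w + (h * eta) *: v)%R.
    by apply/rowP => i; rewrite !mxE; ring.
  have nv : enorm ((h * eta) *: v)%R = (h * eta)%R.
    by rewrite enormZ v1 mulr1 gtr0_norm.
  have zx2 : (h * eta * (1 - sg) <= dotv (z - x)%R v)%R.
    have := dotv_le_enorm (- w)%R v1; rewrite enormN dotvNl.
    by rewrite zx !dotvE (dotv_sphere v1) -/w in zB *; lra.
  split => //; first exact: le_trans (dotv_le_enorm _ v1).
  by have := enormD w ((h * eta) *: v)%R; rewrite -zx nv -/w in zB *; lra.
have Bsub : B `<=` open_cone x v kappa delta `&` eball D x.
  move=> z /Bh[z1 z2 z3]; split.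
    apply/open_coneP; split.
    - by apply: lt_le_trans z1; rewrite mulr_gt0//; lra.
    - by apply: le_lt_trans e1d; rewrite lee_fin; apply: le_trans z2 _; nra.
    - rewrite -/c; apply: lt_le_trans z3.
      have [c0|c0] := leP 0%R c; last first.
        apply: (@le_lt_trans _ _ 0%R); last by rewrite mulr_gt0//; lra.
        by rewrite nmulr_rle0// enorm_ge0.
      apply: (@le_lt_trans _ _ (c * (h * eta * (1 + sg)))%R).
        by rewrite ler_wpM2l.
      by rewrite mulrCA ltr_pM2l.
  by rewrite /eball/=; apply: le_trans z2 _; nra.
have mB : measurable B by exact: measurable_eball.
have mCB : measurable (open_cone x v kappa delta `&` eball D x).
  apply: measurableI; last exact: measurable_eball.
  by apply: measurable_open; exact: open_cone_open.
apply: (le_trans _ (le_light h x mB mCB Bsub)).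
have k1 z : B z -> ((h ^+ 2 * K1) `^ (- (m.+1%:R / 2)) <= decay h (x - z))%R.
  move=> /Bh[_ z2 _]; apply: decay_ge_sqr => //; rewrite enormBC.
  have : (enorm (z - x) <= 2 * (h * eta))%R by nra.
  by have := enorm_ge0 (z - x)%R; rewrite /K1; nra.
apply: le_trans (light_ge_cst mB (powR_ge0 _ _) k1).
have hs : (0 <= h * (sg * eta))%R by rewrite ltW// mulr_gt0// mulr_gt0.
apply: (@le_trans _ _ (((h ^+ 2 * K1) `^ (- (m.+1%:R / 2)))%:E *
    ((h * (sg * eta) / m.+1%:R *+ 2) ^+ m)%:E)); last first.
  by rewrite lee_wpmul2l ?lee_fin ?powR_ge0//; exact: lebesgue_eball_ge.
rewrite -EFinM lee_fin (powRM _ (sqr_ge0 h) (ltW K10)).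
rewrite (sqr_powR_half (ltW h0)) (powR_halfV h0).
rewrite (_ : h * (sg * eta) / m.+1%:R *+ 2 =
    h * (sg * eta / m.+1%:R *+ 2))%R; last first.
  by rewrite mulrnAr !mulrA.
rewrite exprMn /C exprS le_eqVlt; apply/orP; left; apply/eqP.
by field; rewrite expf_neq0 gt_eqF.
Qed.

(** Push a cone whose directions $w$ satisfy $w\cdot e\ge0$ from $R_0e$ back to $re$. Its
points come closer to the origin: their squared distance drops by at least $R_0^2-r^2$,
which is at least a fixed proportion of the squared distance inside the ball of radius
$D$. The height $h$ uses up half of that gain; the other half yields the factor exceeding
$1$. *)
Lemma light_cone_translate kappa delta D R0 b : (0 < b < 1)%R -> (0 < R0)%R ->
  (0 < D)%R -> exists2 q, (1 < q)%R & forall h r x e v,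
    (0 < h <= (1 - b) * R0 / 2)%R -> (0 <= r <= b * R0)%R -> sphere e -> sphere v ->
    (forall w, sphere w -> cos (kappa / 2) < dotv w v -> 0 <= dotv w e)%R ->
    q%:E * power_integral (- 1) (open_cone (R0 *: e)%R v kappa delta `&` eball D 0%R)
    <= light (open_cone (x + r *: e)%R v kappa delta `&` eball D x) h x.
Proof.
move=> /andP[b0 b1] R00 D0.
pose t := ((1 - b ^+ 2) * R0 ^+ 2 / (2 * D ^+ 2))%R.
have bb : (0 < 1 - b ^+ 2)%R by nra.
have D2 : (0 < D ^+ 2)%R by rewrite exprn_gt0.
have t0 : (0 < t)%R by rewrite divr_gt0 ?mulr_gt0// exprn_gt0.
have tD : (2 * (t * D ^+ 2) = (1 - b ^+ 2) * R0 ^+ 2)%R.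
  by rewrite /t; field; rewrite gt_eqF.
have ti0 : (0 < (1 + t)^-1)%R by rewrite invr_gt0; lra.
(* The gain in squared distance is a factor $1-t$; as $1-t\le(1+t)^{-1}$, the latter
   serves as well and is positive for every $t$. *)
exists ((1 + t)^-1 `^ (- (m.+1%:R / 2)))%R.
  have one : (1 `^ (- (m.+1%:R / 2)) = 1 :> R)%R by rewrite powR1.
  rewrite -[ltLHS]one; apply: powRN_lt => //.
  by rewrite invf_lt1//; lra.
move=> h r x e v /andP[h0 hR] /andP[r0 rR] e1 v1 wve.
set q := (_ `^ _)%R; have q0 : (0 <= q)%R by exact: powR_ge0.
(* Translation by c takes the vertex $R_0e$ to $x+re$. *)
pose c := (x - (R0 - r) *: e)%R.
pose S := open_cone (R0 *: e)%R v kappa delta `&` eball D 0%R.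
pose A := open_cone (x + r *: e)%R v kappa delta `&` eball D x.
have mcone y : measurable (open_cone y v kappa delta).
  by apply: measurable_open; exact: open_cone_open.
have mS : measurable S by apply: measurableI => //; exact: measurable_eball.
have mA : measurable A by apply: measurableI => //; exact: measurable_eball.
have mTA : measurable ((fun z => z + c)%R @^-1` A).
  by rewrite -[X in measurable X]setTI; exact: measurable_shift.
have closer z : S z -> [/\ (0 < enorm z)%R, A (z + c)%R &
    (enorm (x - (z + c)) ^+ 2 + h ^+ 2 <= (1 + t)^-1 * enorm z ^+ 2)%R].
  move=> [cz zD]; move: (cz) => [s [w [[s0 sd] w1 wv zE]]].
  have we := wve w w1 wv; move: zD; rewrite /eball/= subr0 => zD.
  have n1 : (enorm z ^+ 2 = R0 ^+ 2 + 2 * (R0 * (s * dotv w e)) + s ^+ 2)%R.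
    rewrite enorm_sqr zE !dotvE (dotv_sphere e1) (dotv_sphere w1) (dotvC e w).
    ring.
  have n2 : (enorm (x - (z + c)) ^+ 2 =
      r ^+ 2 + 2 * (r * (s * dotv w e)) + s ^+ 2)%R.
    rewrite (_ : x - (z + c) = - (r *: e + s *: w))%R; last first.
      by rewrite zE /c; apply/rowP => i; rewrite !mxE; ring.
    rewrite enormN enorm_sqr !dotvE (dotv_sphere e1) (dotv_sphere w1) (dotvC e w).
    ring.
  have swe : (0 <= s * dotv w e)%R by rewrite mulr_ge0// ltW.
  have rR0 : (r <= R0)%R by nra.
  have n3 : (enorm (x - (z + c)) ^+ 2 <= enorm z ^+ 2)%R by rewrite n1 n2; nra.
  have gain : (enorm (x - (z + c)) ^+ 2 + h ^+ 2 <= (1 - t) * enorm z ^+ 2)%R.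
    have zD2 : (enorm z ^+ 2 <= D ^+ 2)%R.
      by rewrite ler_sqr ?nnegrE ?enorm_ge0 ?(ltW D0).
    have h2 : (h ^+ 2 <= (1 - b ^+ 2) * R0 ^+ 2 / 2)%R.
      apply: (@le_trans _ _ (((1 - b) * R0 / 2) ^+ 2)%R).
        rewrite ler_sqr ?nnegrE ?(ltW h0)//; apply: le_trans hR; exact: ltW.
      have : (0 < R0 ^+ 2)%R by rewrite exprn_gt0.
      rewrite !exprMn; nra.
    have r2 : (r ^+ 2 <= b ^+ 2 * R0 ^+ 2)%R.
      by rewrite -exprMn ler_sqr ?nnegrE// mulr_ge0// ltW.
    have tz : (t * enorm z ^+ 2 <= t * D ^+ 2)%R by rewrite ler_pM2l.
    have rs : (r * (s * dotv w e) <= R0 * (s * dotv w e))%R by rewrite ler_wpM2r.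
    rewrite n2 mulrBl mul1r {1}n1; lra.
  split.
  - rewrite -(@ltr_sqr _ 0%R) ?nnegrE ?enorm_ge0// expr0n/= n1.
    have : (0 < R0 ^+ 2)%R by rewrite exprn_gt0.
    have : (0 <= R0 * (s * dotv w e))%R by rewrite mulr_ge0// ltW.
    have : (0 <= s ^+ 2)%R by rewrite sqr_ge0.
    lra.
  - split.
      exists s, w; split => //; rewrite zE /c.
      by apply/rowP => i; rewrite !mxE; ring.
    rewrite /eball/= enormBC; apply: le_trans zD.
    by rewrite -ler_sqr ?nnegrE ?enorm_ge0.
  - apply: le_trans gain _; apply: ler_wpM2r; first exact: sqr_ge0.
    by rewrite -[leRHS]mul1r ler_pdivlMr; nra.
have -> : light A h x =
    \int[lebesgue_rV m]_(z in (fun z => z + c)%R @^-1` A)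
      (decay h (x - (z + c)))%:E.
  rewrite lightE -(ge0_integral_preserving (f := fun z => (decay h (x - z))%:E)
    (preserves_shift c) mA)//.
    by apply/measurable_EFinP; exact: measurable_decay.
  by move=> z; rewrite lee_fin decay_ge0.
have md : measurable_fun setT (fun z => (decay h (x - (z + c)))%:E).
  apply/measurable_EFinP.
  exact: (measurableT_comp (measurable_decay h x) (measurable_shift c)).
apply: (@le_trans _ _ (\int[lebesgue_rV m]_(z in S) (decay h (x - (z + c)))%:E));
    last first.
  apply: (ge0_subset_integral _ mS mTA).
  - exact: measurable_funTS.
  - by move=> z _; rewrite lee_fin decay_ge0.
  - by move=> z /closer[].
have mp : measurable_fun S
    (fun z : 'rV[R]_m => (enorm z `^ (- 1 - m%:R))%:E).
  by apply/measurable_EFinP/measurable_funTS; exact: measurable_enorm_powR.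
rewrite /power_integral -(ge0_integralZl_EFin _ mS)//; last first.
  by move=> z _; rewrite lee_fin powR_ge0.
apply: (ge0_le_integral _ mS).
- by move=> z _; rewrite -EFinM lee_fin mulr_ge0// powR_ge0.
- exact: measurable_funeM.
- exact: measurable_funTS.
- move=> z /closer[z0 _ zh]; rewrite -EFinM lee_fin.
  rewrite -sqr_powR_half ?enorm_ge0// /q -powRM ?sqr_ge0 ?(ltW ti0)//.
  exact: decay_ge_sqr.
Qed.

End Estimates.

(** * Location of the centers *)

Section CenterLocation.
Context {R : realType} {m : nat}.
Hypothesis hm : (2 <= m)%N.
Implicit Types (Omega : set 'rV[R]_m) (x e v : 'rV[R]_m).
Local Open Scope ereal_scope.

Let m_gt0 : (0 < m)%N. Proof. exact: ltn_trans hm. Qed.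

Lemma power_integral_cone_rotate kappa delta D r e v : sphere e -> sphere v ->
  power_integral (- 1) (open_cone (r *: e)%R v kappa delta `&` eball D 0%R) =
  power_integral (- 1) (cone_theta (m := m) kappa delta (acos (dotv e v))
    (r *: evec m 0)%R `&` eball D 0%R).
Proof.
move=> e1 v1; have [T [iT Te Tv]] := isometry_plane hm e1 v1.
have [pT _ TZ _] := iT; have Tre : T (r *: evec m 0)%R = (r *: e)%R by rewrite TZ Te.
have mS : measurable (open_cone (r *: e)%R v kappa delta `&` eball D 0%R).
  apply: measurableI; last exact: measurable_eball.
  by apply: measurable_open; exact: open_cone_open.
have preE : T @^-1` (open_cone (r *: e)%R v kappa delta `&` eball D 0%R) =
    cone_theta kappa delta (acos (dotv e v)) (r *: evec m 0)%R `&` eball D 0%R.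
  rewrite preimage_setI (cone_isometry kappa delta iT Tre Tv); congr (_ `&` _).
  by apply/seteqP; split => z; rewrite /eball/= !subr0 linear_isometry_enorm.
have := ge0_integral_preserving
  (f := fun z : 'rV[R]_m => (enorm z `^ (- 1 - m%:R))%:E) pT mS.
rewrite preE => E; apply: etrans (esym (E _ _)) _.
- by apply/measurable_EFinP; exact: measurable_enorm_powR.
- by move=> z; rewrite lee_fin powR_ge0.
- by apply: eq_integral => z _ /=; rewrite linear_isometry_enorm.
Qed.

(** By rotation invariance the cone is one of those over which the infimum
$E(\tilde R)=0$ is taken. *)
Lemma tildeR_cone_weight kappa delta D R0 e v : (0 < R0)%R ->
  let Rt := tildeR m (- 1) kappa delta D R0 in
  (0 < Rt)%R -> sphere e -> sphere v ->
  (0 <= acos (dotv e v) <= (pi - kappa) / 2)%R ->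
  power_integral (- 1) (shell D R0 : set 'rV[R]_m) <=
  power_integral (- 1) (open_cone (Rt *: e)%R v kappa delta `&` eball D 0%R).
Proof.
move=> R00 Rt Rt0 e1 v1 te.
have E0 : E_tildeR m (- 1) kappa delta D R0 Rt = 0.
  move: Rt0; rewrite /Rt /tildeR; case: xgetP => [_ _ []//|_].
  by rewrite ltxx.
have fin : power_integral (- 1) (shell D R0 : set 'rV[R]_m) \is a fin_num.
  rewrite ge0_fin_numE; first exact: shell_weight_lty.
  by apply: integral_ge0 => z _; rewrite lee_fin powR_ge0.
rewrite power_integral_cone_rotate// -sube_ge0; last by rewrite fin ?orbT.
rewrite -E0; apply: ereal_inf_lbound => /=.
by exists (acos (dotv e v)); rewrite // in_itv.
Qed.

(** For small heights a center keeps away from the boundary: the complement contains a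
cone with vertex at every point of its closure, and the illumination lost in a cone
with vertex at the center itself is unbounded as $h\to0$. *)
Lemma center_dist_gt0 Omega kappa delta : body Omega ->
  (0 < kappa <= pi)%R -> 0 < delta ->
  uniform_interior_cone (~` Omega) kappa delta ->
  exists2 h1, (0 < h1)%R & forall h x, (0 < h < h1)%R ->
    illuminating_center Omega h x -> (0 < distv x (~` Omega))%R.
Proof.
move=> bO hk d0 hC; set D := diam Omega; set r := inradius Omega.
have r0 : (0 < r)%R := inradius_gt0 m_gt0 bO.
have rD : (r < D)%R := inradius_lt_diam m_gt0 bO.
have D0 := lt_trans r0 rD.
have [C C0 hCone] := light_cone_vertex (m := m) hk d0 D0.
pose K := fine (power_integral (- 1) (shell D r : set 'rV[R]_m)).
have Klty := shell_weight_lty (m := m) D r0.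
have Kgt0 := shell_weight_gt0 m_gt0 (introT andP (conj r0 rD)).
have KE : K%:E = power_integral (- 1) (shell D r : set 'rV[R]_m).
  by rewrite fineK// ge0_fin_numE// ltW.
have K0 : (0 < K)%R by rewrite -lte_fin KE.
exists (Num.min 1 (C / K))%R; first by rewrite lt_min ltr01 divr_gt0.
move=> h x /andP[h0]; rewrite lt_min => /andP[h1 hCK] xmax.
rewrite lt_neqAle distv_ge0 andbT; apply/eqP => dx.
have [y cy xy] := distv_closure_attained x (body_setC_nonempty m_gt0 bO).
have {xy}yx : y = x.
  by apply/esym/eqP; rewrite -subr_eq0; apply/eqP/enorm_eq0; rewrite xy -dx.
rewrite yx in cy; have [v v1 vO] := interior_cone_closure hC cy.
have h01 : (0 < h <= 1)%R by rewrite h0 ltW.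
have sub : light (open_cone x v kappa delta `&` eball D x) h x <=
    light (eball D x `\` Omega) h x.
  apply: le_light.
  - apply: measurableI; last exact: measurable_eball.
    by apply: measurable_open; exact: open_cone_open.
  - apply: measurableD; first exact: measurable_eball.
    by apply: measurable_closed; exact: body_closed.
  - by move=> z [/vO].
have := le_trans (hCone h x v h01 v1)
  (le_trans sub (center_shadow m_gt0 bO h0 xmax)).
rewrite -/D -/r -KE lee_fin leNgt => /negP; apply.
by rewrite ltr_pdivlMr// [ltLHS]mulrC -ltr_pdivlMr.
Qed.

(** The ball inscribed around the center and the exterior cone at the nearest boundary
point are disjoint, so the cone opens away from the center. *)
Lemma cone_dir_nonobtuse Omega kappa delta x y v :
  0 < delta -> (0 < distv x (~` Omega))%R -> enorm (x - y) = distv x (~` Omega) ->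
  open_cone y v kappa delta `<=` ~` Omega ->
  forall w, sphere w -> (cos (kappa / 2) < dotv w v)%R -> (0 <= dotv w (y - x))%R.
Proof.
move=> d0 r0 xy vO w w1 wv; set r := distv x _ in r0 xy.
rewrite leNgt; apply/negP => wy.
have [e1 e10 e1d] := lte_fin_slack d0; rewrite add0r in e1d.
pose s := Num.min e1 (- dotv w (y - x))%R.
have s0 : (0 < s)%R by rewrite lt_min e10 oppr_gt0.
have s1 : (s <= e1)%R by rewrite ge_min lexx.
have s2 : (s <= - dotv w (y - x))%R by rewrite ge_min lexx orbT.
have zC : (~` Omega) (y + s *: w)%R.
  apply: vO; exists s, w; split => //; split => //.
  by apply: le_lt_trans e1d; rewrite lee_fin.
have := distv_le x zC; rewrite -/r leNgt => /negP; apply.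
rewrite enormBC enorm_lt ?(ltW r0)//.
rewrite (_ : y + s *: w - x = (y - x) + s *: w)%R; last by rewrite addrAC.
have -> : (r ^+ 2 = dotv (y - x) (y - x))%R by rewrite -enorm_sqr enormBC xy.
have -> (d : 'rV[R]_m) : dotv (d + s *: w)%R (d + s *: w)%R =
    (dotv d d + 2 * (s * dotv w d) + s ^+ 2)%R.
  by rewrite !dotvE (dotv_sphere w1) (dotvC d w); ring.
nra.
Qed.

(** If the distance $r$ were positive but less than $b\tilde R$, the exterior cone at the
nearest boundary point would be a translate toward $x$ of a cone with vertex at
distance $\tilde R$. The light lost in it would then exceed the weight of the shell by
the factor of light_cone_translate, contradicting center_shadow. *)
Lemma center_dist_ge Omega kappa delta b : body Omega ->
  (0 < kappa <= pi)%R -> 0 < delta ->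
  uniform_interior_cone (~` Omega) kappa delta -> (0 < b < 1)%R ->
  let Rt := tildeR m (- 1) kappa delta (diam Omega) (inradius Omega) in
  exists2 h1, (0 < h1)%R & forall h x, (0 < h < h1)%R ->
    illuminating_center Omega h x -> (0 < distv x (~` Omega))%R ->
    (b * Rt <= distv x (~` Omega))%R.
Proof.
move=> bO hk d0 hC hb Rt; set D := diam Omega; set r0 := inradius Omega.
have r00 : (0 < r0)%R := inradius_gt0 m_gt0 bO.
have rD : (r0 < D)%R := inradius_lt_diam m_gt0 bO.
have D0 := lt_trans r00 rD; have /andP[b0 b1] := hb.
(* The case $\tilde R\le0$ covers the default value of tildeR. *)
have [Rt0|Rt0] := leP Rt 0%R.
  exists 1%R => // h x _ _ r1; apply: le_trans (ltW r1).
  by rewrite pmulr_rle0.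
have [q q1 hq] := light_cone_translate (m := m) kappa delta hb Rt0 D0.
exists ((1 - b) * Rt / 2)%R; first by rewrite divr_gt0// mulr_gt0// subr_gt0.
move=> h x /andP[h0 h1] xmax; set r := distv x _ => r1.
rewrite leNgt; apply/negP => rb.
have [y cy xy] := distv_closure_attained x (body_setC_nonempty m_gt0 bO).
have [v v1 vO] := interior_cone_closure hC cy.
have wv := cone_dir_nonobtuse d0 r1 xy vO.
rewrite -/r in xy; pose e := (r^-1 *: (y - x))%R.
have e1 : sphere e.
  rewrite /sphere/= /e enormZ enormBC xy gtr0_norm ?invr_gt0// mulVf//.
  by rewrite gt_eqF.
have ye : y = (x + r *: e)%R.
  by rewrite /e scalerA divff ?gt_eqF// scale1r addrC subrK.
have we w : sphere w -> (cos (kappa / 2) < dotv w v)%R -> (0 <= dotv w e)%R.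
  by move=> w1 cw; rewrite /e dotvZr mulr_ge0 ?wv// invr_ge0 ltW.
have acos_pos : (0 <= acos (dotv e v))%R by exact/acos_ge0/dotv_sphere_itv.
have te : (0 <= acos (dotv e v) <= (pi - kappa) / 2)%R.
  by rewrite acos_pos; exact: cone_angle_le.
have low := tildeR_cone_weight r00 Rt0 e1 v1 te.
have Klty := shell_weight_lty (m := m) D r00.
have Kgt0 := shell_weight_gt0 m_gt0 (introT andP (conj r00 rD)).
have hh : (0 < h <= (1 - b) * Rt / 2)%R by rewrite h0 ltW.
have hr : (0 <= r <= b * Rt)%R by rewrite !ltW.
have sub : light (open_cone (x + r *: e)%R v kappa delta `&` eball D x) h x <=
    light (eball D x `\` Omega) h x.
  apply: le_light.
  - apply: measurableI; last exact: measurable_eball.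
    by apply: measurable_open; exact: open_cone_open.
  - apply: measurableD; first exact: measurable_eball.
    by apply: measurable_closed; exact: body_closed.
  - by move=> z [+ zD]; rewrite -ye => /vO.
have up := le_trans (hq h r x e v hh hr e1 v1 we)
  (le_trans sub (center_shadow m_gt0 bO h0 xmax)).
have q0 : (0 <= q)%R by rewrite ltW// (lt_trans ltr01).
have := le_trans (lee_wpmul2l _ low) up; rewrite lee_fin => /(_ q0).
rewrite -/D -/r0 -[X in _ <= X]mul1e => {low up}.
have /fineK <- : power_integral (- 1) (shell D r0 : set 'rV[R]_m) \is a fin_num.
  by rewrite ge0_fin_numE// ltW.
have K0 : (0 < fine (power_integral (- 1) (shell D r0 : set 'rV[R]_m)))%R.
  by rewrite fine_gt0// Kgt0.
by rewrite -!EFinM lee_fin ler_pM2r// leNgt q1.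
Qed.

End CenterLocation.

Theorem corollary5p4 (R : realType) (m : nat) (hm : (2 <= m)%N)
  (Omega : set 'rV[R]_m) (kappa : R) (delta : \bar R)
  (hOmega : body Omega)
  (hkappa : 0 < kappa <= pi) (hdelta : (0 < delta)%E)
  (hcone : uniform_interior_cone (~` Omega) kappa delta)
  (b : R) (hb : 0 < b < 1) :
  let Rt := tildeR m (-1) kappa delta (diam Omega) (inradius Omega) in
  exists2 h0 : R, 0 < h0 &
    forall h : R, 0 < h < h0 ->
    forall x : 'rV[R]_m, illuminating_center Omega h x ->
      (inner_parallel Omega (b * Rt) `&` minimal_unfolded_region Omega) x.
Proof.
move=> Rt.
have [h1 h10 H1] := center_dist_gt0 hm hOmega hkappa hdelta hcone.
have [h2 h20 H2] := center_dist_ge hm hOmega hkappa hdelta hcone hb.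
exists (Num.min h1 h2); first by rewrite lt_min h10.
move=> h /andP[h0]; rewrite lt_min => /andP[hh1 hh2] x xmax.
have d0 : 0 < distv x (~` Omega) by apply: (H1 h); rewrite // h0.
split; last exact: center_in_unfolded hOmega h0 xmax.
split; last by apply: (H2 h); rewrite // h0.
apply: contrapT => nx; have := distv_le (A := ~` Omega) x nx.
by rewrite subrr enorm0 leNgt d0.
Qed.
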